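(* Let $X$ be a Banach space, $n>1$ an integer, $\Omega_1,\ldots,\Omega_n\subset X$ nonempty closed sets, $\widehat\Omega:=\Omega_1\times\cdots\times\Omega_n$, and $\alpha>0$. Suppose that either $X$ is Asplund or $\Omega_1,\ldots,\Omega_n$ are convex. The collection $\{\Omega_1,\ldots,\Omega_n\}$ is approximately $\alpha$-stationary (respectively, approximately stationary) at a sequence $\sigma_{\mathbf{x}_0}:=\{\mathbf{x}_0^k\}\subset\widehat\Omega$ if and only if there exist $\mathbf{x}^k:=(x_1^k,\ldots,x_n^k)\in\widehat\Omega$ and $x_i^{*k}\in N_{\Omega_i}(x_i^k)$ $(i=1,\ldots,n,\ k=1,2,\ldots)$ such that $\mathbf{x}^k-\mathbf{x}_0^k\to0$ as $k\to+\infty$, $\sum_{i=1}^n\|x_i^{*k}\|=1$ for all $k\in\mathbb{N}$, and $$\limsup_{k\to+\infty}\Big\|\sum_{i=1}^n x_i^{*k}\Big\|<\alpha\qquad\Big(\text{respectively, }\lim_{k\to+\infty}\sum_{i=1}^n x_i^{*k}=0\Big).$$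
   Context: Notation. $X^n$ carries the maximum norm. $d(x,S)$ is the point-to-set distance, $d(x,\emptyset)=+\infty$. For $\mathbf{x}=(x_1,\ldots,x_n)\in X^n$, $\zeta(\mathbf{x}):=d\big(0,\bigcap_{i=1}^n(\Omega_i-x_i)\big)$. For $c>0$, $c/0:=+\infty$ and $c/(+\infty):=0$. Normal cone. Here $N$ is the Fréchet normal cone: for $\bar x\in\Omega$, $N_\Omega(\bar x)$ is the set of $x^*\in X^*$ with $\limsup_{\Omega\ni x\to\bar x,\,x\neq\bar x}\langle x^*,x-\bar x\rangle/\|x-\bar x\|\le0$; for convex $\Omega$ this is the normal cone of convex analysis (and coincides with the Clarke normal cone). Stationarity. Let $\sigma_{\mathbf{x}}=\{\mathbf{x}^k\}\subset\widehat\Omega$ and $\sigma_{\mathbf{a}}=\{\mathbf{a}^k\}\subset X^n\setminus\{0\}$ with $\mathbf{a}^k\to0$. Put $$\alpha(\sigma_{\mathbf{x}};\sigma_{\mathbf{a}}):=\limsup_{k\to+\infty}\frac{\|\mathbf{a}^k\|}{\zeta(\mathbf{x}^k+\mathbf{a}^k)},\qquad \widetilde\alpha(\sigma_{\mathbf{x}};\sigma_{\mathbf{a}}):=\inf\big\{\alpha(\sigma_{\mathbf{u}};\sigma_{\mathbf{a}})\mid \sigma_{\mathbf{u}}=\{\mathbf{u}^k\}\subset\widehat\Omega,\ \mathbf{u}^k-\mathbf{x}^k\to0\big\}.$$ The collection $\{\Omega_1,\ldots,\Omega_n\}$ is approximately $\alpha$-stationary (resp. approximately stationary) at $\sigma_{\mathbf{x}}$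 if $\widetilde\alpha(\sigma_{\mathbf{x}};\sigma_{\mathbf{a}})<\alpha$ (resp. $\widetilde\alpha(\sigma_{\mathbf{x}};\sigma_{\mathbf{a}})=0$) for some $\sigma_{\mathbf{a}}=\{\mathbf{a}^k\}\subset X^n\setminus\{0\}$ with $\mathbf{a}^k\to0$. *)

(* Defs.v *)
From HB Require Import structures.
From mathcomp Require Import all_boot all_order all_algebra.
From mathcomp Require Import all_classical all_reals all_analysis.

Set Implicit Arguments.
Unset Strict Implicit.
Unset Printing Implicit Defensive.

Import Order.TTheory GRing.Theory Num.Theory.
Import numFieldNormedType.Exports.

Local Open Scope classical_set_scope.
Local Open Scope ring_scope.

(* Fréchet differentiability is the library's [differentiable]; only the values
   of [f] on the open set [D] matter. *)
Definition asplund (R : realType) (X : completeNormedModType R) : Prop :=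
  forall (D : set X) (f : X -> R^o),
    open D -> convex_set (D : set (convex_lmodType X)) ->
    convex_function (D : set (convex_lmodType X)) f ->
    {in D, continuous f} ->
    D `<=` closure (D `&` [set x | differentiable f x]).

(* The topological dual is represented as a set of functions, so that sums of
   functionals are sums in the function space. *)
Definition dual_space (R : realType) (X : normedModType R) : set (X -> R^o) :=
  [set f | linear f /\ continuous f].

(* A real supremum: meaningful only for [f] bounded on the unit ball, as are
   all members of [dual_space X]. *)
Definition dual_norm (R : realType) (X : normedModType R) (f : X -> R^o) : R :=
  sup [set `|f x| | x in [set x | `|x| <= 1]].

(* When [xbar] is isolated in [Omega] the upper limit is -oo and the cone is
   the whole dual. *)
Definition frechet_normal_cone (R : realType) (X : normedModType R)
    (Omega : set X) (xbar : X) : set (X -> R^o) :=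
  [set f | dual_space f /\
    (limf_esup (fun x : X => (f (x - xbar) / `|x - xbar|)%:E)
      (within Omega xbar^') <= 0)%E].

Definition max_norm (R : realType) (X : normedModType R) (n : nat)
    (x : 'I_n -> X) : R :=
  \big[Num.max/0]_(i < n) `|x i|.

Definition product_set (X : Type) (n : nat) (Omega : 'I_n -> set X) :
    set ('I_n -> X) :=
  [set x | forall i, Omega i (x i)].

(* [edist_inf S x] is the distance from [x] to [S], with value +oo for the empty
   set; on a normed module [edist] is the distance of the norm, see below. *)
Definition zeta (R : realType) (X : normedModType R) (n : nat)
    (Omega : 'I_n -> set X) (x : 'I_n -> X) : \bar R :=
  edist_inf (\bigcap_(i in [set: 'I_n]) [set w - x i | w in Omega i]) 0.

Lemma edist_normE (R : realType) (X : normedModType R) (x y : X) :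
  edist (x, y) = `|x - y|%:E.
Proof.
apply/eqP; rewrite eq_le; apply/andP; split.
- apply/lee_addgt0Pr => e e0; rewrite -EFinD; apply: edist_fin => /=.
    by rewrite ltr_wpDl.
  by rewrite -ball_normE /ball_/= ltrDl.
- apply: le_ereal_inf_tmp => _ [r [r0 +] <-] /=.
  by rewrite -ball_normE /ball_/= lee_fin => /ltW.
Qed.

(* Division in [\bar R] follows c / 0 = +oo (c > 0) and c / +oo = 0. *)
Definition stat_ratio (R : realType) (X : normedModType R) (n : nat)
    (Omega : 'I_n -> set X) (x a : nat -> 'I_n -> X) : \bar R :=
  limn_esup (fun k => (max_norm (a k))%:E / zeta Omega (x k + a k)%R)%E.

Definition approx_stat_ratio (R : realType) (X : normedModType R) (n : nat)
    (Omega : 'I_n -> set X) (x a : nat -> 'I_n -> X) : \bar R :=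
  ereal_inf [set stat_ratio Omega u a | u in
    [set u : nat -> 'I_n -> X | (forall k, product_set Omega (u k)) /\
      max_norm (u k - x k) @[k --> \oo] --> (0 : R)]].

Definition null_nonzero_seq (R : realType) (X : normedModType R) (n : nat)
    (a : nat -> 'I_n -> X) : Prop :=
  (forall k, a k <> 0) /\ max_norm (a k) @[k --> \oo] --> (0 : R).

Definition approx_alpha_stationary (R : realType) (X : normedModType R)
    (n : nat) (alpha : R) (Omega : 'I_n -> set X)
    (x : nat -> 'I_n -> X) : Prop :=
  exists2 a, null_nonzero_seq a & (approx_stat_ratio Omega x a < alpha%:E)%E.

Definition approx_stationary (R : realType) (X : normedModType R)
    (n : nat) (Omega : 'I_n -> set X) (x : nat -> 'I_n -> X) : Prop :=
  exists2 a, null_nonzero_seq a & approx_stat_ratio Omega x a = 0%E.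

(* Main.v *)
Require Import Defs.
From HB Require Import structures.
From mathcomp Require Import all_boot all_order all_algebra.
From mathcomp Require Import all_classical all_reals all_analysis.
From mathcomp Require Import ring lra.

Set Implicit Arguments.
Unset Strict Implicit.
Unset Printing Implicit Defensive.

Import Order.TTheory GRing.Theory Num.Theory.
Import numFieldNormedType.Exports.

Local Open Scope classical_set_scope.
Local Open Scope ring_scope.

(* The functional of an approximately stationary configuration is produced by a
   variational principle and turned into normals by convex duality. If the
   shifted sets have no common point in a ball of radius [|a| / alpha'], Ekeland's
   principle applied to the maximum of [|v i - u i - a i - z|] gives a pair
   [(v, z)] which is almost minimal. Minimising over the common shift [z] leaves
   a seminorm [q] on [X^n]; a functional [f <= q] has [|sum f_i| <= alpha'] (test
   it on the diagonal), and [sum |f_i|] is close to 1 if [f b] is close to the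
   norm of the residual [b]. It remains to find such an [f] with [- f] normal to
   the product set near [v]. For convex sets this is the Hahn-Banach theorem.

   In an Asplund space, existence of a Frechet normal is first reduced to a
   separable closed set [Y] of directions: by Hahn-Banach a normal with the
   required bounds exists iff no finite combination of points of the set
   violates an inequality, and [Y] is closed under choosing violating
   combinations. The dual ball is norm-separable over [Y] (otherwise
   a weak*-compact set has no small slice, contradicting the Asplund property),
   so that [q] and the norm can be uniformly approximated by convex functions
   that are Frechet smooth along [Y]. An Ekeland-type iteration with these smooth
   functions as perturbations yields an exact minimiser [x] of a smooth convex
   function on the trace of the set on [Y], and a subgradient there is the
   required functional. *)

(** For a nonconvex set, minimality at [x] only controls increments towards points [v] of the set,
    whereas a subgradient bounds increments from above. A small second difference at [x] reflects
    one inequality into the other (from [v - x] to [x - v]), so every subgradient at a minimiser is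
    a conormal; this is what smoothness is for.

    All losses are multiples of one [gamma], paid from the gap between the ratio and [alpha]. The
    distance from the given point to the new one is at most a constant times [max_norm a], and the
    constant depends on the gap only, so it vanishes along the sequence.

    Normality demands a radius for every accuracy. The separable reduction stays countable by
    recording finitely many radii, a bound on the weights and a deficit as natural numbers.

    Conversely, given normals, the perturbation consists of short multiples of vectors at which the
    normals almost attain their norms; a common point of the shifted sets too close to 0 would
    violate the summed normal inequalities. *)

Section RealBounds.
Context {R : realType}.
Implicit Types (A : set R).

Lemma inf_le_mem A c x : (forall y, A y -> c <= y) -> A x -> inf A <= x.
Proof. by move=> cA; apply: ge_inf; exists c. Qed.

Lemma inf_ltP A c e : (forall y, A y -> c <= y) -> A !=set0 -> inf A < e ->
  exists2 y, A y & y < e.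
Proof.
move=> cA A0 Ae; have [||y Ay ye] := @inf_adherent R A (e - inf A) _ _.
- by rewrite subr_gt0.
- by split=> //; exists c.
by exists y => //; rewrite addrC subrK in ye.
Qed.

Lemma sup_ge_mem A c x : (forall y, A y -> y <= c) -> A x -> x <= sup A.
Proof. by move=> cA; apply: ub_le_sup; exists c. Qed.

Lemma sup_gtP A c e : (forall y, A y -> y <= c) -> A !=set0 -> e < sup A ->
  exists2 y, A y & e < y.
Proof.
move=> cA A0 Ae; have [||y Ay ye] := @sup_adherent R A (sup A - e) _ _.
- by rewrite subr_gt0.
- by split=> //; exists c.
by exists y => //; rewrite subKr in ye.
Qed.

End RealBounds.

(** * Sublinear functionals and the Hahn-Banach theorem *)

Section LinearFunctionals.
Context {R : realType} {E : lmodType R}.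
Implicit Types (f g p q : E -> R).

Definition linear_fun f := linear (f : E -> R^o).

Lemma lin0 f : linear_fun f -> f 0 = 0.
Proof. by move=> /(_ (-1) 0 0); rewrite scaler0 addr0 scaleN1r addNr. Qed.

Lemma linZ f a x : linear_fun f -> f (a *: x) = a * f x.
Proof. by move=> lf; have := lf a x 0; rewrite !addr0 lin0// addr0. Qed.

Lemma linD f x y : linear_fun f -> f (x + y) = f x + f y.
Proof. by move=> lf; have := lf 1 x y; rewrite !scale1r. Qed.

Lemma linN f x : linear_fun f -> f (- x) = - f x.
Proof. by move=> lf; rewrite -scaleN1r linZ// mulN1r. Qed.

Lemma linB f x y : linear_fun f -> f (x - y) = f x - f y.
Proof. by move=> lf; rewrite linD// linN. Qed.

Lemma linear_funP f :
  (forall x y, f (x + y) = f x + f y) -> (forall a x, f (a *: x) = a * f x) ->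
  linear_fun f.
Proof. by move=> fD fZ a x y; rewrite fD fZ. Qed.

Definition sublinear p :=
  (forall x y, p (x + y) <= p x + p y) /\
  (forall (t : R) x, 0 < t -> p (t *: x) = t * p x).

Lemma sublin0 p : sublinear p -> p 0 = 0.
Proof. by case=> _ /(_ 2 0 (ltr0Sn _ _)); rewrite scaler0; lra. Qed.

Lemma sublinZ p t x : sublinear p -> 0 <= t -> p (t *: x) = t * p x.
Proof.
move=> sp; rewrite le_eqVlt => /orP[/eqP<-|]; last exact: sp.2.
by rewrite scale0r mul0r sublin0.
Qed.

Lemma sublinN p x : sublinear p -> - p (- x) <= p x.
Proof. by move=> sp; have := sp.1 x (- x); rewrite subrr sublin0//; lra. Qed.

(** For sublinear [p] this is sublinear, below [p], and [t = 1] gives [tilt p y (- y) <= - p y]. A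
    minimal sublinear functional equals its tilts, hence is odd, hence linear. *)
Let tilt p y x := inf [set p (x + t *: y) - t * p y | t in [set t | 0 <= t]].

Let tilt_lb p y x z : sublinear p ->
  [set p (x + t *: y) - t * p y | t in [set t | 0 <= t]] z -> - p (- x) <= z.
Proof.
move=> sp [t /= t0 <-]; have := sp.1 (x + t *: y) (- x).
by rewrite [x + _]addrC addrK sublinZ//; lra.
Qed.

Let tilt_le p y x t : sublinear p -> 0 <= t ->
  tilt p y x <= p (x + t *: y) - t * p y.
Proof. by move=> sp t0; apply: inf_le_mem; [move=> z; exact: tilt_lb|exists t]. Qed.

Let tilt_sublinear p y : sublinear p -> sublinear (tilt p y).
Proof.
move=> sp.
have ne x : [set p (x + t *: y) - t * p y | t in [set t | 0 <= t]] !=set0.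
  by exists (p (x + 0 *: y) - 0 * p y); exists 0 => //=.
split.
- move=> x1 x2; apply/ler_addgt0Pr => e e0.
  have [|_ [t1 /= t10 <-] h1] := inf_ltP (fun z => @tilt_lb p y x1 z sp) (ne x1)
    (_ : tilt p y x1 < tilt p y x1 + e / 2); first by lra.
  have [|_ [t2 /= t20 <-] h2] := inf_ltP (fun z => @tilt_lb p y x2 z sp) (ne x2)
    (_ : tilt p y x2 < tilt p y x2 + e / 2); first by lra.
  have := @tilt_le p y (x1 + x2) (t1 + t2) sp (addr_ge0 t10 t20).
  have := sp.1 (x1 + t1 *: y) (x2 + t2 *: y).
  by rewrite addrACA -scalerDl; lra.
- move=> s x s0.
  have key u x' : 0 < u -> tilt p y (u *: x') <= u * tilt p y x'.
    move=> u0; rewrite -ler_pdivrMl//; apply: lb_le_inf; first exact: ne.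
    move=> _ [t /= t0 <-]; rewrite ler_pdivrMl//.
    have := @tilt_le p y (u *: x') (u * t) sp (mulr_ge0 (ltW u0) t0).
    by rewrite -scalerA -scalerDr sp.2// mulrBr mulrA.
  apply/eqP; rewrite eq_le key//=.
  have := key s^-1 (s *: x); rewrite scalerA mulVf ?gt_eqF// scale1r invr_gt0.
  by move=> /(_ s0); rewrite ler_pdivlMl.
Qed.

(** Zorn's lemma for the reversed pointwise order. A chain is bounded by its pointwise infimum,
    finite because every sublinear [g <= p] satisfies [- p (- x) <= g x]. *)
Let minimal_sublinear p : sublinear p ->
  exists2 f, sublinear f /\ (forall x, f x <= p x) &
    forall g, sublinear g -> (forall x, g x <= f x) -> g = f.
Proof.
move=> sp; pose T := {g : E -> R | sublinear g /\ forall x, g x <= p x}.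
pose le (g h : T) := `[< forall x, sval h x <= sval g x >].
have [||||[f [sf fp]] fmax] := @Zorn T le.
- by move=> g; apply/asboolP.
- move=> r s t /asboolP rs /asboolP st; apply/asboolP => x.
  exact: le_trans (st x) (rs x).
- move=> [g Pg] [h Ph] /asboolP /= gh /asboolP /= hg; apply: eq_exist.
  by apply/funext => x; apply/eqP; rewrite eq_le gh hg.
- move=> A totA; have [->|/set0P[g0 Ag0]] := eqVneq A set0.
    by exists (exist _ p (conj sp (fun=> lexx _))).
  pose S x := [set sval g x | g in A].
  have Slb x z : S x z -> - p (- x) <= z.
    move=> [[g [sg gp]] Ag <-] /=.
    by apply: le_trans (sublinN x sg); rewrite lerN2.
  have S0 x : S x !=set0 by exists (sval g0 x); exists g0.
  have Sle x (g : T) : A g -> inf (S x) <= sval g x.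
    by move=> Ag; apply: inf_le_mem; [exact: Slb|exists g].
  have sm : sublinear (fun x => inf (S x)).
    split=> [x y|t x t0].
    - apply/ler_addgt0Pr => e e0.
      have [|_ [g Ag <-] hg] := inf_ltP (Slb x) (S0 x)
        (_ : inf (S x) < inf (S x) + e / 2); first by lra.
      have [|_ [h Ah <-] hh] := inf_ltP (Slb y) (S0 y)
        (_ : inf (S y) < inf (S y) + e / 2); first by lra.
      have [/asboolP /(_ x) gh|/asboolP /(_ y) gh] := totA _ _ Ag Ah.
        by have := (svalP h).1.1 x y; have := Sle (x + y) _ Ah; lra.
      by have := (svalP g).1.1 x y; have := Sle (x + y) _ Ag; lra.
    - apply/eqP; rewrite eq_le; apply/andP; split.
        rewrite -ler_pdivrMl//; apply: lb_le_inf => // _ [g Ag <-].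
        rewrite ler_pdivrMl//.
        by have := Sle (t *: x) _ Ag; rewrite (svalP g).1.2.
      apply: lb_le_inf => // _ [g Ag <-].
      by rewrite (svalP g).1.2//; apply: ler_wpM2l (ltW t0) _ _ (Sle x g Ag).
  have mp x : inf (S x) <= p x by apply: le_trans (Sle x _ Ag0) ((svalP g0).2 x).
  exists (exist _ (fun x => inf (S x)) (conj sm mp)) => g Ag.
  by apply/asboolP => x /=; exact: Sle.
exists f => // g sg gf.
have gp x : g x <= p x by apply: le_trans (gf x) (fp x).
have := fmax (exist _ g (conj sg gp)) => /=.
have -> : le (exist _ f (conj sf fp)) (exist _ g (conj sg gp)) by apply/asboolP.
by move=> /(_ isT) [].
Qed.

(** Minimising below [tilt p b] instead of [p] forces [f (- b) <= - p b], which gives equality at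
    [b]. *)
Theorem hahn_banach p b : sublinear p ->
  exists f, [/\ linear_fun f, forall x, f x <= p x & f b = p b].
Proof.
move=> sp; have [f [sf fp] fmin] := minimal_sublinear (@tilt_sublinear p b sp).
have fN y : f (- y) = - f y.
  have : tilt f y = f.
    apply: fmin; first exact: tilt_sublinear.
    by move=> x; have := @tilt_le f y x 0 sf (lexx _); rewrite scale0r addr0; lra.
  move=> /(congr1 (@^~ (- y))) fE; have := @tilt_le f y (- y) 1 sf ler01.
  rewrite fE scale1r addNr sublin0//; have := sublinN y sf; lra.
have lf : linear_fun f.
  apply: linear_funP => [x y|a x].
    apply/eqP; rewrite eq_le sf.1/=; have := sf.1 (- x) (- y).
    by rewrite -opprD !fN; lra.
  have [a0|a0] := leP 0 a; first by rewrite sublinZ.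
  by rewrite -[a]opprK scaleNr fN sublinZ ?oppr_ge0 ?ltW//; ring.
have tp x : tilt p b x <= p x.
  by have := @tilt_le p b x 0 sp (lexx _); rewrite scale0r addr0; lra.
exists f; split=> // [x|]; first exact: le_trans (fp x) (tp x).
apply/eqP; rewrite eq_le (le_trans (fp b) (tp b))/=.
have := @tilt_le p b (- b) 1 sp ler01; rewrite scale1r addNr sublin0//.
by have := fp (- b); rewrite fN; lra.
Qed.

(* The cone [C] of pairs encodes the constraints [- s <= f k]. *)
Lemma hahn_banach_cone p (C : set (E * R)) b beta : sublinear p ->
  (forall x, 0 <= p x) ->
  C (0, 0) -> (forall x y, C x -> C y -> C (x + y)) ->
  (forall t x, 0 < t -> C x -> C (t *: x.1, t * x.2)) ->
  (forall x, C x -> 0 <= x.2) ->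
  (forall x, C x -> beta <= p (b + x.1) + x.2) ->
  exists f, [/\ linear_fun f, forall x, f x <= p x,
    forall x, C x -> - x.2 <= f x.1 & beta <= f b].
Proof.
move=> sp p0 C0 CD CZ Cge Cb.
pose S x := [set p (x + c.1) + c.2 | c in C].
(* Infimal convolution of [p] with the cone: a linear [f <= P] is below [p] (take [c = 0]) and obeys
   the constraints (evaluate at [- c.1]), so Hahn-Banach for [P] at [b] suffices. *)
pose P x := inf (S x).
have Slb x z : S x z -> 0 <= z by move=> [c Cc <-]; rewrite addr_ge0// Cge.
have Sne x : S x !=set0 by exists (p (x + 0) + 0), (0, 0).
have Ple x c : C c -> P x <= p (x + c.1) + c.2.
  by move=> Cc; apply: inf_le_mem; [exact: Slb|exists c].
have PZ t x : 0 < t -> P (t *: x) <= t * P x.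
  move=> t0; rewrite -ler_pdivrMl//; apply: lb_le_inf => // _ [c Cc <-].
  rewrite ler_pdivrMl//; have := Ple (t *: x) _ (CZ _ _ t0 Cc) => /=.
  by rewrite -scalerDr sp.2// mulrDr.
have sP : sublinear P.
  split=> [x y|t x t0].
    apply/ler_addgt0Pr => e e0.
    have [|_ [c Cc <-] hc] := inf_ltP (Slb x) (Sne x)
      (_ : P x < P x + e / 2); first by lra.
    have [|_ [d Cd <-] hd] := inf_ltP (Slb y) (Sne y)
      (_ : P y < P y + e / 2); first by lra.
    have := Ple (x + y) _ (CD _ _ Cc Cd); have := sp.1 (x + c.1) (y + d.1).
    by rewrite addrACA /=; lra.
  apply/eqP; rewrite eq_le PZ//=.
  have := @PZ t^-1 (t *: x); rewrite scalerA mulVf ?gt_eqF// scale1r invr_gt0.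
  by move=> /(_ t0); rewrite ler_pdivlMl.
have [f [lf fP fb]] := hahn_banach b sP; exists f; split=> //.
- by move=> x; apply: le_trans (fP x) _; have := Ple x _ C0; rewrite !addr0.
- move=> c Cc; rewrite lerNl -linN//; apply: le_trans (fP _) _.
  by have := Ple (- c.1) _ Cc; rewrite addNr sublin0// add0r.
- by rewrite fb; apply: lb_le_inf => // _ [c Cc <-]; exact: Cb.
Qed.

End LinearFunctionals.

(** * Ekeland's variational principle for a pseudometric *)

Section Ekeland.
Context {R : realType}.

Definition harm (n : nat) : R := n.+1%:R^-1.

Lemma harm_gt0 n : 0 < harm n.
Proof. by rewrite invr_gt0. Qed.

Lemma harm_lt (e : R) : 0 < e -> exists n : nat, harm n < e.
Proof.
move=> e0; have [n _ /(_ _ (leqnn _)) nP] := near_infty_natSinv_lt (PosNum e0).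
by exists n.
Qed.

Lemma le_harm (m n : nat) : (m <= n)%N -> harm n <= harm m.
Proof. by move=> mn; rewrite lef_pV2 ?posrE// ler_nat. Qed.

Context {T : Type}.
Implicit Types (d : T -> T -> R) (A : set T) (u : nat -> T).

Definition seq_cvg d u l :=
  forall e, 0 < e -> exists N, forall n, (N <= n)%N -> d (u n) l <= e.

Definition seq_cauchy d u := forall e, 0 < e ->
  exists N, forall m n, (N <= m)%N -> (m <= n)%N -> d (u m) (u n) <= e.

Definition seq_complete d A := forall u, (forall n, A (u n)) ->
  seq_cauchy d u -> exists2 l, A l & seq_cvg d u l.

Lemma ekeland d A (phi : T -> R) x0 :
  (forall x, d x x = 0) -> (forall x y, d x y = d y x) ->
  (forall x y, 0 <= d x y) -> (forall x y z, d x z <= d x y + d y z) ->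
  seq_complete d A -> (forall x, 0 <= phi x) ->
  (forall x e, 0 < e -> exists2 r, 0 < r &
     forall y, d y x <= r -> phi x <= phi y + e) ->
  A x0 -> exists2 x, A x /\ phi x + d x0 x <= phi x0 &
    forall y, A y -> phi x <= phi y + d x y.
Proof.
move=> dxx dC d0 dT cA phi0 lsc Ax0.
pose S x := [set y | A y /\ phi y + d x y <= phi x].
have Sxx x : A x -> S x x by move=> Ax; split=> //; rewrite dxx addr0.
have ST x y z : S x y -> S y z -> S x z.
  by move=> [Ay xy] [Az yz]; split=> //; have := dT x y z; lra.
have step (nx : nat * T) : exists y, A nx.2 -> S nx.2 y /\
    forall z, S nx.2 z -> phi y <= phi z + harm nx.1.
  case: nx => n x /=; have [Ax|nAx] := pselect (A x); last by exists x.
  pose P := [set phi z | z in S x].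
  have P0 z : P z -> 0 <= z by move=> [? _ <-].
  have [||_ [y Sy <-] hy] := @inf_ltP _ P 0 (inf P + harm n) P0.
  - by exists (phi x), x => //; exact: Sxx.
  - by rewrite ltrDl harm_gt0.
  exists y => _; split=> // z Sz; apply: le_trans (ltW hy) _.
  by rewrite lerD2r; apply: inf_le_mem P0 _; exists z.
have [s sP] := choice step.
pose u := fix u n := if n is m.+1 then s (m, u m) else x0.
have uA n : A (u n).
  by elim: n => [//|n IH] /=; have [[]] := sP (n, u n) IH.
have uS n : S (u n) (u n.+1) by have [] := sP (n, u n) (uA n).
have uSS m n : (m <= n)%N -> S (u m) (u n).
  move=> /subnK <-; elim: (n - m)%N => [|k IH]; first exact: Sxx.
  by rewrite addSn; exact: ST IH (uS _).
(* [u n.+1] almost minimises [phi] on [S (u n)], which contains [S (u n.+1)]; so the latter has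
   radius at most [harm n]. *)
have close n y : S (u n.+1) y -> d (u n.+1) y <= harm n.
  move=> Sy; have [_ /(_ y (ST _ _ _ (uS n) Sy)) h] := sP (n, u n) (uA n).
  have {}h : phi (u n.+1) <= phi y + harm n by [].
  by case: Sy => _; lra.
have [|x Ax ux] := cA u uA.
  move=> e e0; have [|N Ne] := harm_lt (_ : 0 < e / 2); first by lra.
  exists N.+1 => m n Nm mn.
  have := close N _ (uSS _ _ Nm); have := close N _ (uSS _ _ (leq_trans Nm mn)).
  by have := dT (u m) (u N.+1) (u n); rewrite (dC (u m) (u N.+1)); lra.
have xS n : S (u n) x.
  split=> //; apply/ler_addgt0Pr => e e0.
  have [|r r0 rP] := lsc x (e / 2) (_ : 0 < e / 2); first by lra.
  have [|N NP] := ux (Num.min r (e / 2)); first by rewrite lt_min r0; lra.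
  have [_ h] := uSS _ _ (leq_maxr N n).
  have := NP _ (leq_maxl N n); rewrite le_min => /andP[/rP h1 h2].
  by have := dT (u n) (u (maxn N n)) x; lra.
exists x; first by split=> //; have [] := xS 0%N.
move=> y Ay; rewrite leNgt; apply/negP => lty.
have Sy : S x y by split=> //; lra.
have dxy : d y x <= 0.
  apply/ler_addgt0Pr => e e0; rewrite add0r.
  have [|N Ne] := harm_lt (_ : 0 < e / 2); first by lra.
  have := close N _ (ST _ _ _ (xS N.+1) Sy).
  have := close N _ (xS N.+1).
  by have := dT y (u N.+1) x; rewrite (dC y (u _)); lra.
have yx : d y x = 0 by apply/eqP; rewrite eq_le dxy d0.
(* A pseudometric may vanish off the diagonal: [d y x = 0] does not give [y = x], and the
   contradiction comes from lower semicontinuity. *)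
have [e [e0 le]] : exists e, 0 < e /\ phi y + e < phi x.
  by exists ((phi x - phi y) / 2); have := d0 x y; lra.
have [r' r'0 /(_ y)] := lsc x e e0.
by rewrite yx (ltW r'0); lra.
Qed.

End Ekeland.

(** * Weak* compactness of polars *)

Section PointwiseCompactness.
Context {R : realType} {E : lmodType R}.
Implicit Types (f g p q : E -> R) (C : set (E -> R)).

(** Closure for pointwise convergence, that is weak* closure, expressed by finite sets of test
    points. *)
Definition adherent C f :=
  forall (s : seq E) (e : R), 0 < e -> exists2 g, C g & forall x, x \in s -> `|g x - f x| < e.

Definition pclosed C := forall f, adherent C f -> C f.

(** For [q] a norm this is the closed dual unit ball; the bound carries the continuity. *)
Definition polar q : set (E -> R) := [set f | linear_fun f /\ forall x, f x <= q x].

Lemma polar_pclosed q : pclosed (polar q).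
Proof.
move=> f adf; split.
- apply: linear_funP => [x y|a x]; apply/eqP; rewrite -subr_eq0 -normr_le0.
  + apply/ler_addgt0Pr => e e0; rewrite add0r.
    have [|g [lg _] gf] := adf [:: x; y; x + y] (e / 3); first by lra.
    have := gf x; have := gf y; have := gf (x + y).
    rewrite !inE !eqxx !orbT /= => /(_ isT) + /(_ isT) + /(_ isT).
    rewrite linD// !ltr_norml ler_norml; lra.
  + apply/ler_addgt0Pr => e e0; rewrite add0r.
    have a1 : 0 < 1 + `|a| by rewrite ltr_wpDr.
    have [|g [lg _] gf] := adf [:: x; a *: x] (e / (1 + `|a|)).
      by rewrite divr_gt0.
    have := gf x; have := gf (a *: x).
    rewrite !inE !eqxx !orbT /= => /(_ isT) + /(_ isT).
    rewrite !ltr_pdivlMr// linZ// => h1 h2.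
    have -> : f (a *: x) - a * f x = - (a * g x - f (a *: x)) + a * (g x - f x).
      by ring.
    apply: le_trans (ler_normD _ _) _; rewrite normrN normrM.
    have := normr_ge0 a; have := normr_ge0 (g x - f x).
    have := normr_ge0 (a * g x - f (a *: x)); nra.
- move=> x; apply/ler_addgt0Pr => e e0.
  have [g [_ gq] gf] := adf [:: x] e e0.
  by have := gf x; rewrite inE eqxx ltr_norml => /(_ isT); have := gq x; lra.
Qed.

(** Banach-Alaoglu in the form that Zorn arguments need: the chain is a filter base in the product
    of the segments [[- q (- x), q x]], compact by Tychonoff's theorem. *)
Lemma polar_compact q (G : set (set (E -> R))) : G !=set0 ->
  (forall C, G C -> C !=set0 /\ C `<=` polar q) -> total_on G subset ->
  exists2 f, polar q f & forall C, G C -> adherent C f.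
Proof.
move=> [C0 GC0] GP totG.
have /= cbox := @tychonoff E (fun=> R) (fun x => `[- q (- x), q x]%classic)
  (fun x => @segment_compact R _ _).
pose F : set_system (prod_topology (fun _ : E => R)) := filter_from G id.
have FF : ProperFilter F.
  apply: filter_from_proper; last by move=> C /GP[].
  apply: filter_from_filter; first by exists C0.
  move=> A B GA GB; have [AB|BA] := totG _ _ GA GB.
    by exists A => // x Ax; split=> //; exact: AB.
  by exists B => // x Bx; split=> //; exact: BA.
have Fbox : F [set f | forall i, `[- q (- i), q i]%classic (f i)].
  exists C0 => // f /(proj2 (GP _ GC0))[lf fq] x /=.
  by rewrite in_itv/= fq andbT lerNl -linN.
have [f [_ clf]] := cbox F FF Fbox.
have adf C : G C -> adherent C f.
  move=> GC s e e0.
  have nb : nbhs (f : prod_topology (fun _ : E => R))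
    [set g | forall x, x \in s -> `|g x - f x| < e].
    pose Ff : Filter (nbhs (f : prod_topology (fun _ : E => R))) := nbhs_filter _.
    elim: s => [|y s IH].
      by apply: (@filterS _ _ Ff setT); [move=> g _ x|exact: (@filterT _ _ Ff)].
    have fy : nbhs (f : prod_topology (fun _ : E => R)) [set g | `|g y - f y| < e].
      have /cvgrPdist_lt /(_ e e0) := @proj_continuous E (fun=> R) y f.
      by apply: (@filterS _ _ Ff) => g /=; rewrite distrC.
    apply: (@filterS _ _ Ff) (@filterI _ _ Ff _ _ fy IH) => g [gy gs] x.
    by rewrite inE => /orP[/eqP->|/gs].
  have [g [Cg gP]] := clf C _ (@in_filter_from _ _ G id C GC) nb.
  by exists g.
exists f => //; apply: polar_pclosed => s e e0.
have [g Cg gP] := adf _ GC0 s e e0.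
by exists g => //; exact: (proj2 (GP _ GC0)).
Qed.

(** A cluster point and not the limit of a subsequence: the polar need not be metrizable, so each
    finite set of test points has its own indices. *)
Lemma polar_cluster q (u : nat -> E -> R) : (forall n, polar q (u n)) ->
  exists2 f, polar q f & forall (s : seq E) (e : R) N, 0 < e -> exists2 n, (N <= n)%N &
    forall x, x \in s -> `|u n x - f x| < e.
Proof.
move=> uq; pose G := [set [set u n | n in [set n | (N <= n)%N]] | N in [set: nat]].
have [|||f fq fG] := @polar_compact q G.
- by exists [set u n | n in [set n | (0 <= n)%N]], 0%N.
- move=> _ [N _ <-]; split; last by move=> _ [n _ <-].
  by exists (u N), N => /=.
- move=> _ _ [M _ <-] [N _ <-].
  have [MN|/ltnW NM] := leqP M N; [right|left] => _ [n /= h <-].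
    by exists n => //=; exact: leq_trans h.
  by exists n => //=; exact: leq_trans h.
exists f => // s e N e0.
have [|_ [n /= Nn <-] h] := fG [set u n | n in [set n | (N <= n)%N]] _ s e e0.
  by exists N.
by exists n.
Qed.

End PointwiseCompactness.

(** * Separability of the dual ball over a sequence in an Asplund space *)

Section AsplundDual.
Context {R : realType} {X : completeNormedModType R}.
Implicit Types (f g : X -> R) (C : set (X -> R)).

(** In the second difference the derivative cancels between [h] and [- h], so differentiability is
    expressed without it. *)
Lemma asplund_symmetric_diff (p : X -> R) : asplund X ->
  (forall x y, p x <= p y + `|x - y|) ->
  (forall (t : R) x y, 0 <= t -> t <= 1 ->
     p (t *: x + (1 - t) *: y) <= t * p x + (1 - t) * p y) ->
  exists x, forall e, 0 < e -> exists2 r, 0 < r & forall h, `|h| <= r ->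
    p (x + h) + p (x - h) - 2 * p x <= e * `|h|.
Proof.
move=> aX lip cvx.
have pc : continuous (p : X -> R^o).
  move=> x; apply/cvgrPdist_le => /= e e0; near=> y.
  have xy : `|x - y| <= e by near: y; exact: cvgr_dist_le.
  rewrite ler_distlC; have := lip x y; have := lip y x; rewrite (distrC y x).
  by lra.
have : [set: X] `<=` closure (setT `&` [set x | differentiable (p : X -> R^o) x]).
  apply: aX.
  - exact: openT.
  - by move=> x y l _ _; rewrite inE.
  - move=> t x y _ _; have t0 : 0 <= t%:num by [].
    by have t1 : t%:num <= 1 by []; exact: cvx t0 t1.
  - by move=> x _; exact: pc.
move=> /(_ 0 Logic.I setT filterT)[x [[_ dx] _]]; exists x => e e0.
have /eqaddoE /eqaddoP /(_ (e / 2)) := diff_locally dx.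
rewrite divr_gt0// => /(_ isT) /nbhs_ballP [r /= r0 rP].
exists (r / 2); first by rewrite divr_gt0.
move=> h hr.
have key h' : `|h'| <= r / 2 ->
    `|p (x + h') - p x - 'd (p : X -> R^o) x h'| <= e / 2 * `|h'|.
  move=> h'r; have : ball (0 : X) r h'.
    by rewrite -ball_normE /ball_/= sub0r normrN; lra.
  by move=> /rP /=; rewrite !fctE /= [h' + x]addrC opprD addrA.
have := key h hr; have := key (- h); rewrite normrN linearN => /(_ hr).
by rewrite !ler_norml; lra.
Unshelve. all: by end_near. Qed.

Variables (S : nat -> X).

Let ball1 := polar (fun x : X => `|x|).

(** Basic weak* neighbourhoods over [S]. The rational bounds make them countably many, so that
    countable nets of boxes can be merged. *)
Let box (l : seq (nat * rat * rat)) : set (X -> R) :=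
  [set f | forall t, t \in l -> ratr t.1.2 < f (S t.1.1) < ratr t.2].

Let near_on (e : R) (f g : X -> R) := forall i, `|f (S i) - g (S i)| <= e * `|S i|.

Let covered e l := exists c : nat -> X -> R, (forall j, ball1 (c j)) /\
  forall f, ball1 f -> box l f -> exists j, near_on e f (c j).

Let box_open l f : box l f -> exists2 e : R, 0 < e &
  forall g, (forall t, t \in l -> `|g (S t.1.1) - f (S t.1.1)| < e) -> box l g.
Proof.
elim: l => [_|t l IH bf]; first by exists 1 => // g _ t; rewrite in_nil.
have [|e e0 eP] := IH; first by move=> t' lt'; apply: bf; rewrite inE lt' orbT.
have /andP[t1 t2] := bf t (mem_head _ _).
exists (Num.min e (Num.min (f (S t.1.1) - ratr t.1.2) (ratr t.2 - f (S t.1.1)))).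
  by rewrite !lt_min e0 !subr_gt0 t1 t2.
move=> g gP t'; rewrite inE => /orP[/eqP->|t'l].
  have := gP t (mem_head _ _); rewrite !lt_min ltr_norml ltr_norml ltr_norml.
  by lra.
apply: eP t'l => u ul; have := gP u; rewrite inE ul orbT => /(_ isT).
by rewrite lt_min => /andP[].
Qed.

Let box_near f n (e : R) : 0 < e -> exists2 l, box l f &
  forall g, box l g -> forall i, (i < n)%N -> `|g (S i) - f (S i)| < e.
Proof.
move=> e0; elim: n => [|n [l lf IH]]; first by exists [::].
have [|q1 Hq1] := @rat_in_itvoo R (f (S n) - e) (f (S n)); first by lra.
have [|q2 Hq2] := @rat_in_itvoo R (f (S n)) (f (S n) + e); first by lra.
move: Hq1 Hq2; rewrite !in_itv/= => Hq1 Hq2.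
exists ((n, q1, q2) :: l).
  by move=> t; rewrite inE => /orP[/eqP-> /=|]; [lra|exact: lf].
move=> g gl i; rewrite ltnS leq_eqVlt => /orP[/eqP->|].
  have := gl _ (mem_head _ _); rewrite /= ltr_norml; lra.
by apply: IH => t tl; apply: gl; rewrite inE tl orbT.
Qed.

(** The net is the union of the nets of all covered boxes, together with [a]; [pickle] merges the
    code of the box with the index in its net, and [None] stands for [a]. *)
Let cover_all e (a : X -> R) (A : set (X -> R)) : ball1 a ->
  (forall f, ball1 f -> A f -> near_on e f a \/ exists2 l, box l f & covered e l) ->
  exists c : nat -> X -> R, (forall j, ball1 (c j)) /\
    forall f, ball1 f -> A f -> exists j, near_on e f (c j).
Proof.
move=> Ba fA.
have /choice[c cP] : forall l, exists c : nat -> X -> R,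
    (forall j, ball1 (c j)) /\ (covered e l ->
    forall f, ball1 f -> box l f -> exists j, near_on e f (c j)).
  move=> l.
  have [[c [c1 c2]]|nc] := pselect (covered e l); first by exists c.
  by exists (fun=> a).
pose d k := if unpickle k is Some (Some (l, j)) then c l j else a.
exists d; split.
  move=> k; rewrite /d; case: (unpickle k) => [[[l j]|]|] //.
  by have [] := cP l.
move=> f Bf Af; have [fa|[l lf cl]] := fA f Bf Af.
  exists (pickle (None : option (seq (nat * rat * rat) * nat))).
  by rewrite /d pickleK.
have [j jP] := (cP l).2 cl f Bf lf.
exists (pickle (Some (l, j) : option (seq (nat * rat * rat) * nat))).
by rewrite /d pickleK.
Qed.

Let ball1_0 : ball1 (fun=> 0).
Proof. by split=> // a x y /=; rewrite scaler0 addr0. Qed.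

(* [A] is the set of functionals all of whose weak* neighbourhoods over [S] are
   not countably coverable. If [A] were nonempty, a minimal weak*-closed
   subset of [A] with the same trace on [S] would have a small slice, because
   its support function has a point of differentiability. *)
Let core_empty e : asplund X -> 0 < e ->
  forall f, ball1 f -> exists2 l, box l f & covered e l.
Proof.
move=> aX e0 f0 Bf0; apply: contrapT => f0N.
pose A := [set f | ball1 f /\ forall l, box l f -> ~ covered e l].
have Af0 : A f0 by split=> // l bl cl; apply: f0N; exists l.
have Acl : pclosed A.
  move=> f adf; split.
    apply: polar_pclosed => s r r0; have [g [Bg _] gf] := adf s r r0.
    by exists g.
  move=> l /box_open[r r0 rP] cl.
  have [g [_ gA] gP] := adf [seq S t.1.1 | t <- l] r r0.
  apply: gA cl; apply: rP => t tl; apply: gP.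
  by apply/mapP; exists t.
pose good C := [/\ C `<=` A, pclosed C &
  forall a, A a -> exists2 f, C f & forall i, f (S i) = a (S i)].
pose T := {C | good C}.
pose le (C D : T) := `[< sval D `<=` sval C >].
have [||||[C1 [C1A C1cl C1tr]] C1min] := @Zorn T le.
- by move=> C; apply/asboolP.
- by move=> C D D' /asboolP CD /asboolP DD'; apply/asboolP => x /DD' /CD.
- move=> [C gC] [D gD] /asboolP /= CD /asboolP /= DC; apply: eq_exist.
  by apply/seteqP.
- move=> F totF; have [->|/set0P[D0 FD0]] := eqVneq F set0.
    have gA : good A by split=> // a Aa; exists a.
    by exists (exist _ A gA).
  pose I := \bigcap_(D in F) sval D.
  have gI : good I.
    split=> [f If|f adf D FD|a Aa].
    + by have [+ _ _] := svalP D0; apply; exact: If.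
    + have [_ + _] := svalP D; apply => s r r0.
      by have [g Ig gP] := adf s r r0; exists g => //; exact: Ig.
    (* The fibre of [D] over the trace of [a]. These fibres form a chain of nonempty sets, and a
       common adherent point shows that the intersection still has full trace. *)
    pose H (D : T) := sval D `&` [set f | forall i, f (S i) = a (S i)].
    have [|||f Bf fP] := @polar_compact _ _ (fun x : X => `|x|) (H @` F).
    + by exists (H D0), D0.
    + move=> _ [D FD <-]; split.
        by have [_ _ /(_ a Aa)[f Df fa]] := svalP D; exists f.
      by move=> f [Df _]; have [/(_ _ Df)[]] := svalP D.
    + move=> _ _ [D FD <-] [D' FD' <-].
      have [/asboolP h|/asboolP h] := totF _ _ FD FD'; [right|left] => f [Df fa].
        by split=> //; exact: h.
      by split=> //; exact: h.
    exists f.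
      move=> D FD; have [_ + _] := svalP D; apply => s r r0.
      by have [|g [Dg _] gP] := fP (H D) _ s r r0; [exists D|exists g].
    move=> i; apply/eqP; rewrite -subr_eq0 -normr_le0.
    apply/ler_addgt0Pr => r r0; rewrite add0r.
    have [|g [_ ga] gP] := fP (H D0) _ [:: S i] r r0; first by exists D0.
    by rewrite -ga distrC; apply/ltW/gP; rewrite inE.
  exists (exist _ I gI) => D FD; apply/asboolP => f If; exact: If.
have [g0 C1g0 _] := C1tr _ Af0.
have C1B f : C1 f -> ball1 f by move=> /C1A[].
pose vals x := [set f x | f in C1].
have vub x z : vals x z -> z <= `|x| by move=> [f /C1B[_ fB] <-].
have vne x : vals x !=set0 by exists (g0 x), g0.
pose p x := sup (vals x).
have pge f x : C1 f -> f x <= p x.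
  by move=> C1f; apply: sup_ge_mem (vub x) _; exists f.
have [|t x y t0 t1|x xP] := asplund_symmetric_diff aX (p := p).
- move=> x y; apply: ge_sup => // _ [f C1f <-].
  have [lf /(_ (x - y))] := C1B _ C1f; rewrite linB//.
  by have := pge _ y C1f; lra.
- apply: ge_sup => // _ [f C1f <-].
  have [lf _] := C1B _ C1f; rewrite linD// !(linZ _ _ lf).
  by apply: lerD; apply: ler_wpM2l; rewrite ?subr_ge0//; exact: pge.
have [|r r0 rP] := xP (e / 4); first by lra.
(* For [f] and [g] within [s] of the support value at [x] and [h] of norm [r], differentiability
   yields [f h - g h <= e / 4 * r + 2 * s], below [e * r]. *)
pose s := e * r / 16.
have s0 : 0 < s by rewrite /s; nra.
pose C2 := C1 `&` [set f | f x <= p x - s].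
have slice f g : C1 f -> C1 g -> ~ C2 f -> ~ C2 g -> near_on e f g.
  have key f' g' : C1 f' -> C1 g' -> ~ C2 f' -> ~ C2 g' ->
      forall i, f' (S i) - g' (S i) <= e * `|S i|.
    move=> Cf Cg Nf Ng i.
    have [lf _] := C1B _ Cf; have [lg _] := C1B _ Cg.
    have fx : p x - s < f' x by rewrite ltNge; apply/negP => h; apply: Nf.
    have gx : p x - s < g' x by rewrite ltNge; apply/negP => h; apply: Ng.
    have [->|Si] := eqVneq (S i) 0; first by rewrite (lin0 lf) (lin0 lg) normr0 mulr0 subrr.
    have Si0 : 0 < `|S i| by rewrite normr_gt0.
    pose h := (r / `|S i|) *: S i.
    have hr : `|h| = r.
      rewrite normrZ ger0_norm ?divr_ge0 ?ltW// divfK// gt_eqF//.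
    have := rP h; rewrite hr lexx => /(_ isT).
    have := pge _ (x + h) Cf; have := pge _ (x - h) Cg.
    rewrite (linD _ _ lf) (linB _ _ lg) => h1 h2 h3.
    have : f' h - g' h <= e * r by rewrite /s in fx gx; nra.
    rewrite /h (linZ _ _ lf) (linZ _ _ lg) -mulrBr mulrAC ler_pdivrMr//.
    by rewrite [e * r]mulrC -mulrA ler_pM2l.
  move=> Cf Cg Nf Ng i; rewrite ler_norml.
  by have := key f g Cf Cg Nf Ng i; have := key g f Cg Cf Ng Nf i; lra.
(* [C2] is [C1] without the slice. By minimality it cannot be good; being closed and inside [A], it
   must have lost the trace of some member of [A]. *)
have C2N : ~ good C2.
  move=> gC2; have := C1min (exist _ C2 gC2).
  have -> : le (exist _ C1 (And3 C1A C1cl C1tr)) (exist _ C2 gC2).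
    by apply/asboolP => f [].
  move=> /(_ isT)[C21].
  have [|_ [f C1f <-] hf] := @sup_gtP _ (vals x) `|x| (p x - s) (vub x) (vne x).
    by rewrite /p; lra.
  by move: C1f; rewrite -C21 => -[_ /=]; lra.
have [a Aa aN] : exists2 a, A a & forall f, C2 f -> ~ forall i, f (S i) = a (S i).
  apply: contrapT => H; apply: C2N; split.
  - by move=> f [/C1A].
  - move=> f adf; split.
      by apply: (C1cl) => q u u0; have [g [C1g _] gP] := adf q u u0; exists g.
    apply/ler_addgt0Pr => u u0.
    have [g [_ gx] gP] := adf [:: x] u u0.
    by have := gP x; rewrite inE eqxx ltr_norml => /(_ isT); move: gx => /=; lra.
  - move=> a Aa; apply: contrapT => H'; apply: H; exists a => // f C2f fa.
    by apply: H'; exists f.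
(* Compactness: if every box around [a] met [C2], a cluster point in [C2] would have the trace of
   [a]. *)
have [l la lN] : exists2 l, box l a & forall f, C2 f -> ~ box l f.
  apply: contrapT => H.
  pose G n := C2 `&` [set f | forall i, (i < n)%N -> `|f (S i) - a (S i)| < harm n].
  have [|||f Bf fP] := @polar_compact _ _ (fun x : X => `|x|) [set G n | n in setT].
  - by exists (G 0%N), 0%N.
  - move=> _ [n _ <-]; split; last by move=> f [[/C1B]].
    apply: contrapT => Gn; apply: H.
    have [l la lP] := box_near a n (@harm_gt0 R n).
    exists l => // f C2f lf; apply: Gn; exists f; split=> //; exact: lP.
  - have GS m n : (m <= n)%N -> G n `<=` G m.
      move=> mn f [C2f fn]; split=> // i im.
      exact: lt_le_trans (fn i (leq_trans im mn)) (le_harm mn).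
    by move=> _ _ [m _ <-] [n _ <-]; have [/GS|/ltnW/GS] := leqP m n; [right|left].
  have C2f : C2 f.
    split.
      apply: (C1cl) => q u u0.
      by have [|g [[C1g _] _] gP] := fP (G 0%N) _ q u u0; [exists 0%N|exists g].
    apply/ler_addgt0Pr => u u0.
    have [|g [[_ gx] _] gP] := fP (G 0%N) _ [:: x] u u0; first by exists 0%N.
    by have := gP x; rewrite inE eqxx ltr_norml => /(_ isT); move: gx => /=; lra.
  apply: aN C2f _ => i; apply/eqP; rewrite -subr_eq0 -normr_le0.
  apply/ler_addgt0Pr => u u0; rewrite add0r.
  have [|N hN] := @harm_lt R (u / 2); first by lra.
  pose n := maxn N i.+1.
  have [||g [_ /(_ i) gi] gP] := fP (G n) _ [:: S i] (u / 2).
  - by exists n.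
  - by lra.
  have {}gi := gi (leq_maxr N i.+1).
  have := gP (S i); rewrite inE eqxx => /(_ isT).
  have := @le_harm R _ _ (leq_maxl N i.+1).
  by move: gi; rewrite !ltr_norml ler_norml; lra.
(* Members of [A] in the box [l] have the trace of a slice element and are thus near [a]; its other
   members lie in covered boxes. So [l] is covered, against [a] in [A]. *)
case: (Aa) => Ba /(_ l la); apply.
apply: cover_all Ba _ => f Bf lf.
have [Af|nAf] := pselect (A f); last first.
  right; apply: contrapT => H; apply: nAf; split=> // l' l'f cl'.
  by apply: H; exists l'.
left.
have [f1 C1f1 f1f] := C1tr _ Af; have [a1 C1a1 a1a] := C1tr _ Aa.
move=> i; rewrite -f1f -a1a; apply: slice => //.
  by move=> /lN; apply => t /lf; rewrite f1f.
by move=> /lN; apply => t /la; rewrite a1a.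
Qed.

(** A Lindelof argument: each functional lies in one of countably many covered boxes, so the ball
    has a countable net for every [harm n]. *)
Lemma asplund_dual_separable : asplund X ->
  exists c : nat -> X -> R, (forall j, polar (fun x : X => `|x|) (c j)) /\
  forall f e, polar (fun x : X => `|x|) f -> 0 < e ->
    exists j, forall i, `|f (S i) - c j (S i)| <= e * `|S i|.
Proof.
move=> aX.
have /choice[c cP] : forall n, exists c : nat -> X -> R, (forall j, ball1 (c j)) /\
    forall f, ball1 f -> setT f -> exists j, near_on (harm n) f (c j).
  move=> n; apply: cover_all ball1_0 _ => f Bf _.
  by right; apply: core_empty => //; exact: harm_gt0.
pose d k := if unpickle k is Some (n, j) then c n j else fun=> 0.
exists d; split.
  move=> k; rewrite /d; case: (unpickle k) => [[n j]|]; last exact: ball1_0.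
  exact: (cP n).1.
move=> f e Bf e0; have [n ne] := harm_lt e0.
have [j jP] := (cP n).2 f Bf Logic.I.
exists (pickle (n, j)) => i; rewrite /d pickleK.
by apply: le_trans (jP i) _; rewrite ler_wpM2r// ltW.
Qed.

End AsplundDual.

Section Seminorms.
Context {R : realType} {E : lmodType R}.
Implicit Types (f g : E -> R).

Definition seminorm (p : E -> R) :=
  (forall x y, p (x + y) <= p x + p y) /\
  (forall (t : R) x, p (t *: x) = `|t| * p x).

Variables (p : E -> R) (sp : seminorm p).

Lemma seminorm_sublinear : sublinear p.
Proof. by split=> [|t x t0]; [exact: sp.1|rewrite sp.2 gtr0_norm]. Qed.

Lemma seminorm0 : p 0 = 0. Proof. exact: sublin0 seminorm_sublinear. Qed.

Lemma seminormN x : p (- x) = p x.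
Proof. by rewrite -scaleN1r sp.2 normrN1 mul1r. Qed.

Lemma seminormB x y : p (x - y) = p (y - x).
Proof. by rewrite -opprB seminormN. Qed.

Lemma seminorm_ge0 x : 0 <= p x.
Proof. by have := sp.1 x (- x); rewrite subrr seminorm0 seminormN; lra. Qed.

Lemma polar_norm f x : polar p f -> `|f x| <= p x.
Proof.
by move=> [lf fp]; rewrite ler_norml fp lerNl -(linN _ lf) -seminormN fp.
Qed.

End Seminorms.

(** * Convex approximations of a seminorm, smooth along a set of directions *)

Section SmoothApproximation.
Context {R : realType} {E : lmodType R}.
Variables (Nm q : E -> R) (Y : set E) (c : nat -> E -> R) (B t : R).
Hypotheses (sNm : seminorm Nm) (sq : seminorm q) (qNm : forall x, q x <= Nm x).
Hypotheses (Y0 : Y 0) (B_gt0 : 0 < B) (t0 : 0 < t)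
  (cl : forall j, linear_fun (c j))
  (cB : forall f j h, polar Nm f -> `|f h - c j h| <= B * Nm h).
Hypothesis c_dense : forall f e, polar Nm f -> 0 < e ->
  exists j, forall h, Y h -> `|f h - c j h| <= e * Nm h.
Implicit Types f g : E -> R.

Let Nm0 x : 0 <= Nm x := seminorm_ge0 sNm x.

(** The dual distance over [Y]. Where [Nm h = 0] the quotient is 0 by convention, consistently,
    since [cB] makes [f] and [c j] agree there. *)
Let dist f j := sup [set `|f h - c j h| / Nm h | h in Y].
Let B0 : 0 <= B. Proof. exact: ltW. Qed.

Let qpolar f : polar q f -> polar Nm f.
Proof. by move=> [lf fq]; split=> // x; exact: le_trans (fq x) (qNm x). Qed.

Let dist_ub f j z : polar Nm f ->
  [set `|f h - c j h| / Nm h | h in Y] z -> z <= B.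
Proof.
move=> pf [h _ <-]; have [Nh|Nh] := eqVneq (Nm h) 0.
  by rewrite Nh invr0 mulr0.
have Nh0 : 0 < Nm h by rewrite lt_neqAle eq_sym Nh Nm0.
by rewrite ler_pdivrMr//; exact: cB.
Qed.

Let dist_ne f j : [set `|f h - c j h| / Nm h | h in Y] !=set0.
Proof. by exists (`|f 0 - c j 0| / Nm 0); exists 0. Qed.

Let dist_ge f j h : polar Nm f -> Y h -> `|f h - c j h| <= dist f j * Nm h.
Proof.
move=> pf Yh; have [Nh|Nh] := eqVneq (Nm h) 0.
  by have := cB j h pf; rewrite Nh !mulr0.
have Nh0 : 0 < Nm h by rewrite lt_neqAle eq_sym Nh Nm0.
rewrite -ler_pdivrMr//; apply: sup_ge_mem (fun z => @dist_ub f j z pf) _.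
by exists h.
Qed.

Let dist_le f j e : 0 <= e -> (forall h, Y h -> `|f h - c j h| <= e * Nm h) ->
  dist f j <= e.
Proof.
move=> e0 fe; apply: ge_sup => // _ [h Yh <-].
have [Nh|Nh] := eqVneq (Nm h) 0; first by rewrite Nh invr0 mulr0.
have Nh0 : 0 < Nm h by rewrite lt_neqAle eq_sym Nh Nm0.
by rewrite ler_pdivrMr//; exact: fe.
Qed.

Let dist_ge0 f j : polar Nm f -> 0 <= dist f j.
Proof.
move=> pf; apply: sup_ge_mem (fun z => @dist_ub f j z pf) _.
by exists 0 => //; rewrite (lin0 pf.1) (lin0 (cl j)) subrr normr0 mul0r.
Qed.

Let dist_leB f j : polar Nm f -> dist f j <= B.
Proof. by move=> pf; apply: dist_le => // h _; exact: cB. Qed.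

Let w j : R := 2^-1 ^+ j.+1.
Let w_gt0 j : 0 < w j. Proof. by rewrite exprn_gt0. Qed.

Let sum_w N : \sum_(j < N) w j <= 1.
Proof.
suff : \sum_(j < N) w j <= 1 - 2^-1 ^+ N.
  by have := @exprn_ge0 R N 2^-1; rewrite invr_ge0 => /(_ (ler0n _ _)); lra.
elim: N => [|N IH]; first by rewrite big_ord0 expr0 subrr.
rewrite big_ord_recr /=; apply: le_trans (lerD IH (lexx _)) _.
by rewrite /w exprS; lra.
Qed.

(** [F] is a weighted series of squared distances to a dense sequence, as in locally uniformly
    convex renormings; its sum is taken as the supremum of the partial sums. *)
Let psum N f := \sum_(j < N) w j * dist f j ^+ 2.
Let F f := sup [set psum N f | N in [set: nat]].

Let psum_le N f : polar Nm f -> psum N f <= B ^+ 2.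
Proof.
move=> pf; apply: le_trans (_ : (\sum_(j < N) w j) * B ^+ 2 <= _); last first.
  by rewrite -[leRHS]mul1r ler_wpM2r// sqr_ge0.
rewrite mulr_suml; apply: ler_sum => j _; apply: ler_wpM2l; first exact: ltW.
by rewrite lerXn2r// ?nnegrE// ?dist_ge0// dist_leB.
Qed.

Let psum_F N f : polar Nm f -> psum N f <= F f.
Proof.
move=> pf; apply: (@sup_ge_mem _ _ (B ^+ 2)); last by exists N.
by move=> _ [N' _ <-]; exact: psum_le.
Qed.

Let F_le f b : (forall N, psum N f <= b) -> F f <= b.
Proof.
move=> fb; apply: ge_sup; first by exists (psum 0 f), 0%N.
by move=> _ [N _ <-].
Qed.

Let F_ge0 f : polar Nm f -> 0 <= F f.
Proof. by move=> pf; have := psum_F 0 pf; rewrite /psum big_ord0. Qed.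

Let mid f g : E -> R := fun x => 2^-1 * (f x + g x).

Let mid_polar p f g : polar p f -> polar p g -> polar p (mid f g).
Proof.
move=> [lf fp] [lg gp]; split; last first.
  by move=> x; rewrite /mid; have := fp x; have := gp x; lra.
apply: linear_funP => [x y|a x]; rewrite /mid.
  by rewrite (linD _ _ lf) (linD _ _ lg); ring.
by rewrite (linZ _ _ lf) (linZ _ _ lg); ring.
Qed.

Let dist_mid f g j : polar Nm f -> polar Nm g ->
  dist (mid f g) j <= 2^-1 * (dist f j + dist g j).
Proof.
move=> pf pg; have := dist_ge0 j pf; have := dist_ge0 j pg => g0 f0.
apply: dist_le => [|h Yh]; first by lra.
have := dist_ge j pf Yh; have := dist_ge j pg Yh.
rewrite /mid !ler_norml; lra.
Qed.

(* Uniform convexity of [F]; the gap controls every [dist _ j]. *)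
Let F_mid f g j : polar Nm f -> polar Nm g ->
  F (mid f g) + w j / 4 * (dist f j - dist g j) ^+ 2 <= (F f + F g) / 2.
Proof.
move=> pf pg; rewrite -lerBrDr; apply: F_le => N.
have pm := mid_polar pf pg.
have : psum N (mid f g) <= psum (maxn N j.+1) (mid f g).
  rewrite /psum -!(big_mkord xpredT (fun j => w j * dist _ j ^+ 2)).
  rewrite (@big_cat_nat _ _ _ N 0 (maxn N j.+1))//= ?leq_maxl//.
  by rewrite lerDl sumr_ge0// => i _; rewrite mulr_ge0 ?sqr_ge0// ltW.
set N' := maxn _ _ => h; rewrite lerBrDr.
have jN : (j < N')%N by exact: leq_maxr.
apply: le_trans (_ : psum N' (mid f g) +
  \sum_(i < N') w i / 4 * (dist f i - dist g i) ^+ 2 <= _).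
  apply: lerD => //; rewrite (bigD1 (Ordinal jN))//= lerDl sumr_ge0// => i _.
  by rewrite mulr_ge0 ?sqr_ge0// divr_ge0// ltW.
have := psum_F N' pf; have := psum_F N' pg => hf hg.
apply: le_trans (_ : (psum N' f + psum N' g) / 2 <= _); last by lra.
rewrite /psum -!big_split/= mulr_suml; apply: ler_sum => i _.
have := dist_mid i pf pg; have := dist_ge0 i pm.
move: (dist _ _) (dist f _) (dist g _) (w_gt0 i) => a x y wi a0 ha.
have : a ^+ 2 <= (2^-1 * (x + y)) ^+ 2.
  by rewrite lerXn2r// ?nnegrE//; lra.
move=> h2; have : w i * a ^+ 2 <= w i * (2^-1 * (x + y)) ^+ 2.
  by rewrite ler_wpM2l// ltW.
by lra.
Qed.

Let tF f : polar Nm f -> t * F f <= t * B ^+ 2.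
Proof. by move=> pf; rewrite ler_pM2l//; apply: F_le => N; exact: psum_le. Qed.

Let vals k := [set f k - t * F f | f in polar q].
Let G k := sup (vals k).

Let vals_ub k z : vals k z -> z <= q k.
Proof.
move=> [f pf <-]; have [_ /(_ k) fk] := pf.
have : 0 <= t * F f by apply: mulr_ge0; [exact: ltW|exact/F_ge0/qpolar].
by lra.
Qed.

Let G_ge k f : polar q f -> f k - t * F f <= G k.
Proof. by move=> pf; apply: sup_ge_mem (@vals_ub k) _; exists f. Qed.

Let vals_ne k : vals k !=set0.
Proof.
have [f [lf fq fk]] := hahn_banach k (seminorm_sublinear sq).
by exists (f k - t * F f), f.
Qed.

Let G_near k e : 0 < e -> exists2 f, polar q f & G k - e < f k - t * F f.
Proof.
move=> e0; have [|_ [f pf <-] h] := sup_gtP (@vals_ub k) (@vals_ne k)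
  (_ : G k - e < G k); first by lra.
by exists f.
Qed.

Let G_lip k h : G (k + h) <= G k + q h.
Proof.
apply: ge_sup => // _ [f pf <-]; rewrite (linD _ _ pf.1).
by have := G_ge k pf; have := pf.2 h; lra.
Qed.

(** A supremum of functions of single values [f h] is lower semicontinuous for pointwise
    convergence; finitely many distances are treated at once because [F] is reached through partial
    sums. *)
Let dist_lsc f N e : polar Nm f -> 0 < e -> exists s : seq E, exists2 r : R, 0 < r &
  forall g, polar Nm g -> (forall x, x \in s -> `|g x - f x| < r) ->
  forall j, (j < N)%N -> dist f j <= dist g j + e.
Proof.
move=> pf e0; elim: N => [|N [s [r r0 IH]]]; first by exists [::], 1.
have [|_ [h Yh <-] hP] := sup_gtP (fun z => @dist_ub f N z pf) (@dist_ne f N)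
  (_ : dist f N - e / 2 < dist f N); first by lra.
have [Nh|Nh] := eqVneq (Nm h) 0.
  exists s, r => // g pg gs j; rewrite ltnS leq_eqVlt => /orP[/eqP->|]; last exact: IH.
  by move: hP; rewrite Nh invr0 mulr0; have := dist_ge0 N pg; lra.
have Nh0 : 0 < Nm h by rewrite lt_neqAle eq_sym Nh Nm0.
exists (h :: s), (Num.min r (e / 2 * Nm h)).
  by rewrite lt_min r0 mulr_gt0// divr_gt0.
move=> g pg gs j; rewrite ltnS leq_eqVlt => /orP[/eqP->|]; last first.
  apply: IH => // x xs; have := gs x; rewrite inE xs orbT => /(_ isT).
  by rewrite lt_min => /andP[].
have := gs h (mem_head _ _); rewrite lt_min => /andP[_ gh].
move: hP; rewrite ltr_pdivlMr// => hP; rewrite -(ler_pM2r Nh0).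
have := dist_ge N pg Yh; have := ler_distD (g h) (f h) (c N h).
by rewrite (distrC (f h) (g h)); lra.
Qed.

Let G_max k : exists2 f, polar q f & G k <= f k - t * F f.
Proof.
have /choice[u uP] : forall n, exists f, polar q f /\ G k - harm n < f k - t * F f.
  by move=> n; have [f pf h] := G_near k (@harm_gt0 R n); exists f.
have [f pf fP] := polar_cluster (fun n => (uP n).1).
exists f => //; have pf' := qpolar pf.
rewrite lerBrDl -lerBrDr mulrC -ler_pdivlMr//; apply: F_le => N.
rewrite ler_pdivlMr// lerBrDr.
apply/ler_addgt0Pr => e e0.
(* Raising a distance of at most [B] by [e1 <= 1] raises its square by at most [e1 * (2 * B + 1)];
   after multiplication by [t] this costs at most [e / 2]. *)
pose e1 := Num.min 1 (e / (2 * (t * (2 * B + 1)))).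
have B2 : 0 < 2 * B + 1 by have := B0; lra.
have tB : 0 < 2 * (t * (2 * B + 1)) by rewrite !mulr_gt0.
have e10 : 0 < e1 by rewrite lt_min ltr01 divr_gt0.
have [s [r r0 sP]] := dist_lsc N pf' e10.
have [|n0 n0e] := @harm_lt R (e / 4); first by lra.
have [|n n0n nP] := fP (k :: s) (Num.min r (e / 4)) n0.
  by rewrite lt_min r0; lra.
have pu := qpolar (uP n).1.
have uk : `|u n k - f k| < e / 4.
  by have := nP k (mem_head _ _); rewrite lt_min => /andP[].
have us j : (j < N)%N -> dist f j <= dist (u n) j + e1.
  apply: sP => // x xs; have := nP x; rewrite inE xs orbT => /(_ isT).
  by rewrite lt_min => /andP[].
have : psum N f <= psum N (u n) + e1 * (2 * B + 1).
  apply: le_trans (_ : psum N (u n) + (\sum_(j < N) w j) * (e1 * (2 * B + 1)) <= _).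
    rewrite mulr_suml -big_split/=; apply: ler_sum => j _; rewrite -mulrDr.
    apply: ler_wpM2l; first exact: ltW.
    have e11 : e1 <= 1 by rewrite ge_min lexx.
    have := us j (ltn_ord j); have := dist_ge0 j pf'; have := dist_leB j pu.
    have := dist_ge0 j pu; move: (dist f j) (dist _ j) => x y y0 yB x0 xy.
    have : x ^+ 2 <= (y + e1) ^+ 2 by rewrite lerXn2r// ?nnegrE//; lra.
    have : y * e1 <= B * e1 by rewrite ler_pM2r.
    have : e1 * e1 <= 1 * e1 by rewrite ler_pM2r.
    by lra.
  rewrite lerD2l -[leRHS]mul1r; apply: ler_wpM2r => //; exact/ltW/mulr_gt0.
have := psum_F N pu; have [_] := uP n; have := @le_harm R _ _ n0n.
have : e1 * (2 * (t * (2 * B + 1))) <= e.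
  by rewrite -ler_pdivlMr// ge_min lexx orbT.
move: uk; rewrite ltr_norml.
move: (psum N f) (psum N (u n)) (F (u n)) (harm n) (harm n0) n0e => x y z a b ab.
move=> h1 h2 h3 h4 h5 h6.
have : t * y <= t * z by rewrite ler_pM2l.
have : t * x <= t * (y + e1 * (2 * B + 1)) by rewrite ler_pM2l//; lra.
by lra.
Qed.

(** Choose [c j] within [e / 3] of the maximiser [f]. Testing [G] at the midpoint of [f] and [g],
    the gap in [F_mid] and this slack force the distances of [f] and [g] to [c j] to differ by at
    most [e / 3]; the triangle inequality through [c j] then gives [e]. *)
Let G_stable k e : 0 < e -> exists2 f, polar q f & exists2 s, 0 < s &
  forall g, polar q g -> G k - s <= g k - t * F g ->
    forall h, Y h -> `|g h - f h| <= e * Nm h.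
Proof.
move=> e0; have [f pf fk] := G_max k; exists f => //.
have [|j jP] := c_dense (qpolar pf) (_ : 0 < e / 3); first by lra.
have tw : 0 < t * w j / 2 by rewrite divr_gt0// mulr_gt0.
exists (t * w j / 2 * (e / 3) ^+ 2).
  by rewrite mulr_gt0// exprn_gt0// divr_gt0.
move=> g pg gk h Yh.
have df : dist f j <= e / 3 by apply: dist_le jP; lra.
have pf' := qpolar pf; have pg' := qpolar pg.
have := F_mid j pf' pg'; have := G_ge k (mid_polar pf pg); rewrite {1}/mid.
have := dist_ge0 j pf'; have := dist_ge0 j pg'.
have := dist_ge j pf' Yh; have := dist_ge j pg' Yh.
move: (F (mid f g)) (F g) (F f) (dist g j) (dist f j) df fk gk.
move=> Fm Fg Ff b a ha fk gk hb1 ha1 b0 a0 Gm Fmle.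
have : t * (Fm + w j / 4 * (a - b) ^+ 2) <= t * ((Ff + Fg) / 2).
  by rewrite ler_pM2l.
move=> hF.
have : t * w j / 2 * (a - b) ^+ 2 <= t * w j / 2 * (e / 3) ^+ 2 by lra.
have e30 : 0 <= e / 3 by lra.
rewrite ler_pM2l// -[leLHS]real_normK ?num_real// ler_sqr ?nnegrE//.
rewrite ler_norml => hab.
have := ler_distD (c j h) (g h) (f h); rewrite (distrC (c j h) (f h)).
have : (a + b) * Nm h <= e * Nm h by rewrite ler_wpM2r//; lra.
by lra.
Qed.

(* [G] is the support function of [polar q] penalised by the uniformly convex
   [F]; its maximisers are strongly exposed along [Y]. *)
Lemma smooth_approximation : exists G : E -> R,
  [/\ forall k, q k - t * B ^+ 2 <= G k, forall k, G k <= q k,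
    forall k h, G (k + h) <= G k + q h,
    forall (s : R) x y, 0 <= s -> s <= 1 ->
      G (s *: x + (1 - s) *: y) <= s * G x + (1 - s) * G y &
    forall k e, 0 < e -> exists2 r, 0 < r & forall h, Y h -> Nm h < r ->
      G (k + h) + G (k - h) - 2 * G k <= e * Nm h].
Proof.
exists G; split.
- move=> k; have [f [lf fq fk]] := hahn_banach k (seminorm_sublinear sq).
  have pf : polar q f by [].
  by have := G_ge k pf; have := tF (qpolar pf); rewrite fk; lra.
- by move=> k; apply: ge_sup => // z /vals_ub.
- exact: G_lip.
- move=> s x y s0 s1; apply: ge_sup => // _ [f pf <-].
  rewrite (linD _ _ pf.1) !(linZ _ _ pf.1).
  have : s * (f x - t * F f) <= s * G x by rewrite ler_wpM2l ?G_ge.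
  have : (1 - s) * (f y - t * F f) <= (1 - s) * G y.
    by rewrite ler_wpM2l ?G_ge ?subr_ge0.
  by lra.
move=> k e e0.
have [|f pf [s s0 fP]] := G_stable k (_ : 0 < e / 4); first by lra.
(* A maximiser at [k + h] or [k - h] up to [e / 4 * Nm h] is one at [k] up to [(2 + e / 4) * Nm h]:
   one [Nm h] for moving [G], one for moving the functional. *)
exists (s / (2 + e / 4)); first by rewrite divr_gt0//; lra.
move=> h Yh; rewrite ltr_pdivlMr; last by lra.
move=> hs; have [Nh|Nh] := eqVneq (Nm h) 0.
  have := G_lip k h; have := G_lip k (- h); rewrite seminormN// Nh.
  by have := qNm h; rewrite Nh; lra.
have Nh0 : 0 < Nm h by rewrite lt_neqAle eq_sym Nh Nm0.
have eN : 0 < e / 4 * Nm h by rewrite mulr_gt0//; lra.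
have [f1 pf1 f1P] := G_near (k + h) eN; have [f2 pf2 f2P] := G_near (k - h) eN.
move: f1P f2P; rewrite (linD _ _ pf1.1) (linB _ _ pf2.1) => f1P f2P.
have := polar_norm sNm h (qpolar pf1); have := polar_norm sNm h (qpolar pf2).
rewrite !ler_norml => b2 b1.
have G1 : G k <= G (k + h) + Nm h.
  by have := G_lip (k + h) (- h); rewrite addrK seminormN//; have := qNm h; lra.
have G2 : G k <= G (k - h) + Nm h.
  by have := G_lip (k - h) h; rewrite subrK; have := qNm h; lra.
have := G_ge k pf1; have := G_ge k pf2 => g2 g1.
have s1 : G k - s <= f1 k - t * F f1 by lra.
have s2 : G k - s <= f2 k - t * F f2 by lra.
have := fP f1 pf1 s1 h Yh; have := fP f2 pf2 s2 h Yh.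
by rewrite !ler_norml; lra.
Qed.

End SmoothApproximation.

(** * A smooth variational principle *)

Section SmoothVariationalPrinciple.
Context {R : realType} {E : lmodType R}.
Variables (Nm : E -> R) (sNm : seminorm Nm) (Y : set E).
Implicit Types (phi H : E -> R) (A : set E).

Definition convex_fun phi := forall (s : R) x y, 0 <= s -> s <= 1 ->
  phi (s *: x + (1 - s) *: y) <= s * phi x + (1 - s) * phi y.

(** For convex functions, differentiability uniform over the directions in [Y], with the derivative
    eliminated; in this form it passes to sums at once. *)
Definition smooth_along phi := forall k (e : R), 0 < e ->
  exists2 r, 0 < r & forall h, Y h -> Nm h < r ->
    phi (k + h) + phi (k - h) - 2 * phi k <= e * Nm h.

Let Nm0 x : 0 <= Nm x := seminorm_ge0 sNm x.

Lemma smooth_alongD phi1 phi2 : smooth_along phi1 -> smooth_along phi2 ->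
  smooth_along (fun x => phi1 x + phi2 x).
Proof.
move=> s1 s2 k e e0.
have [|r1 r10 h1] := s1 k (e / 2); first by lra.
have [|r2 r20 h2] := s2 k (e / 2); first by lra.
exists (Num.min r1 r2); first by rewrite lt_min r10.
move=> h Yh; rewrite lt_min => /andP[/(h1 _ Yh) + /(h2 _ Yh)]; lra.
Qed.

Lemma smooth_along_scale_shift phi (a : R) z : 0 < a -> smooth_along phi ->
  smooth_along (fun x => a * phi (x + z)).
Proof.
move=> a0 s k e e0.
have [|r r0 h] := s (k + z) (e / a); first by rewrite divr_gt0.
exists r => // x Yx xr; have := h x Yx xr.
rewrite mulrAC ler_pdivlMr// (addrAC k z x) (addrAC k z (- x)).
by rewrite [_ * a]mulrC; lra.
Qed.

Lemma convex_funD phi1 phi2 : convex_fun phi1 -> convex_fun phi2 ->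
  convex_fun (fun x => phi1 x + phi2 x).
Proof.
by move=> c1 c2 s x y s0 s1; have := c1 s x y s0 s1; have := c2 s x y s0 s1; lra.
Qed.

Lemma convex_fun_scale_shift phi (a : R) z : 0 < a -> convex_fun phi ->
  convex_fun (fun x => a * phi (x + z)).
Proof.
move=> a0 c s x y s0 s1.
have -> : s *: x + (1 - s) *: y + z = s *: (x + z) + (1 - s) *: (y + z).
  by rewrite !scalerDr addrACA -[s *: z + _]scalerDl subrKC scale1r.
have := c s (x + z) (y + z) s0 s1; rewrite -(ler_pM2l a0); lra.
Qed.

Let p k : R := 2^-1 ^+ k.
Let p_gt0 k : 0 < p k. Proof. by rewrite exprn_gt0. Qed.
Let pS k : p k = 2 * p k.+1. Proof. by rewrite /p exprS; field. Qed.
Let p_small (e : R) : 0 < e -> exists k, p k < e.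
Proof.
move=> e0; have [N Ne] := harm_lt e0; exists N; apply: le_lt_trans Ne.
rewrite /p exprVn lef_pV2 ?posrE ?exprn_gt0// -natrX ler_nat.
by rewrite ltn_expl.
Qed.

(** The Borwein-Preiss scheme: smooth gauges centred at successive near-minimisers are added to
    [phi], with summable weights. The centres converge, and their limit minimises the full sum
    exactly. *)
Lemma smooth_variational_principle A phi (gamma L m : R) :
  A !=set0 -> seq_complete (fun x y => Nm (x - y)) A -> 0 < gamma -> 0 <= L ->
  (forall x h, phi (x + h) <= phi x + L * Nm h) ->
  (forall x, A x -> m <= phi x) -> convex_fun phi -> smooth_along phi ->
  (forall tau, 0 < tau -> exists H, [/\ forall k, Nm k <= H k,
     forall k, H k <= Nm k + tau, forall k h, H (k + h) <= H k + Nm h,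
     convex_fun H & smooth_along H]) ->
  exists Phi x, [/\ A x, forall v, A v -> Phi x <= Phi v, convex_fun Phi,
    smooth_along Phi &
    forall y h, Phi (y + h) - Phi y <= phi (y + h) - phi y + gamma * Nm h].
Proof.
move=> [a0 Aa0] cA g0 L0 phiL phim phic phis HN.
have /choice[H HP] : forall k, exists H, [/\ forall x, Nm x <= H x,
     forall x, H x <= Nm x + p k, forall x h, H (x + h) <= H x + Nm h,
     convex_fun H & smooth_along H] by move=> k; exact: HN.
have p01 : p 0 = 1 by [].
(* The weights sum to [gamma], the Lipschitz constant allowed for the whole perturbation. *)
pose w k := gamma * p k.+1.
have w0 k : 0 < w k by rewrite mulr_gt0.
have Hge0 k x : 0 <= H k x by have [h _ _ _ _] := HP k; exact: le_trans (h x).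
(* A near-minimiser is chosen for every index and function beforehand, because [P k] depends on the
   earlier choices. *)
have /choice[sel selP] : forall kF : nat * (E -> R), exists v, A v /\
    ((forall x, A x -> m <= kF.2 x) -> forall x, A x -> kF.2 v <= kF.2 x + w kF.1 * p kF.1).
  move=> [k F] /=; have [Fm|nF] := pselect (forall x, A x -> m <= F x); last first.
    by exists a0; split.
  pose S := [set F x | x in A].
  have Sm z : S z -> m <= z by move=> [x /Fm + <-].
  have [||_ [v Av <-] h] := @inf_ltP _ S m (inf S + w k * p k) Sm.
  - by exists (F a0), a0.
  - by rewrite ltrDl mulr_gt0.
  exists v; split=> // _ x Ax; apply: le_trans (ltW h) _.
  by rewrite lerD2r; apply: inf_le_mem Sm _; exists x.
pose P := fix P k := if k is j.+1 then
  (fun v => P j v + w j * H j (v - sel (j, P j))) else phi.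
pose u k := sel (k, P k).
have PS k v : P k.+1 v = P k v + w k * H k (v - u k) by [].
have uA k : A (u k) by have [] := selP (k, P k).
have Pmono k n v : (k <= n)%N -> P k v <= P n v.
  move=> /subnK <-; elim: (n - k)%N => [//|j IH].
  by rewrite addSn PS (le_trans IH)// lerDl mulr_ge0// ltW.
have Pm k x : A x -> m <= P k x.
  by move=> Ax; apply: le_trans (Pmono 0%N k x (leq0n k)); exact: phim.
have umin k x : A x -> P k (u k) <= P k x + w k * p k.
  by have [_] := selP (k, P k); apply => y Ay; exact: Pm.
(* Three errors of at most [w k * p k]: the near-minimality of [u k], that of [u k.+1], and the
   value of [H k] at 0. *)
have ustep k : Nm (u k.+1 - u k) <= 3 * p k.
  have := umin k.+1 _ (uA k); rewrite !PS subrr => h1.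
  have h2 := umin k _ (uA k.+1).
  have [/(_ (u k.+1 - u k)) h3 /(_ 0) h4 _ _ _] := HP k.
  rewrite (seminorm0 sNm) add0r in h4; rewrite -(ler_pM2l (w0 k)).
  have h5 : w k * Nm (u k.+1 - u k) <= w k * H k (u k.+1 - u k) by rewrite ler_pM2l.
  have h6 : w k * H k 0 <= w k * p k by rewrite ler_pM2l.
  have h7 : w k.+1 * p k.+1 <= w k * p k.
    rewrite /w (pS k) (pS k.+1); have := mulr_gt0 g0 (mulr_gt0 (p_gt0 k.+2) (p_gt0 k.+2)).
    by lra.
  by lra.
have udist k n : (k <= n)%N -> Nm (u n - u k) <= 6 * (p k - p n).
  move=> /subnK <-; elim: (n - k)%N => [|j IH].
    by rewrite add0n !subrr (seminorm0 sNm) mulr0.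
  rewrite addSn; have := ustep (j + k)%N; have := pS (j + k)%N.
  have := sNm.1 (u (j + k).+1 - u (j + k)%N) (u (j + k)%N - u k).
  by rewrite addrA subrK; lra.
have [|x Ax ux] := cA u uA.
  move=> e e0; have [|N Ne] := @p_small (e / 6); first by lra.
  exists N => i n Ni lin; rewrite (seminormB sNm).
  have := udist i n lin; have := p_gt0 n.
  have : p i <= p N.
    rewrite /p; apply: ler_wiXn2l => //; rewrite ?invr_ge0// invf_le1 ?ler1n//.
  by lra.
have xu k : Nm (x - u k) <= 6 * p k.
  apply/ler_addgt0Pr => e e0; have [N NP] := ux e e0.
  have := NP _ (leq_maxl N k); have := udist _ _ (leq_maxr N k).
  have := sNm.1 (x - u (maxn N k)) (u (maxn N k) - u k); rewrite addrA subrK.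
  rewrite (seminormB sNm x); have := p_gt0 (maxn N k); lra.
have tail k n y h : (k <= n)%N ->
    P n (y + h) - P n y <= P k (y + h) - P k y + gamma * (p k - p n) * Nm h.
  move=> /subnK <-; elim: (n - k)%N => [|j IH].
    by rewrite add0n subrr mulr0 mul0r addr0.
  rewrite addSn !PS; have [_ _ HL _ _] := HP (j + k)%N.
  have := HL (y - u (j + k)%N) h; rewrite (addrAC y _ h) -(ler_pM2l (w0 (j + k)%N)).
  by move: IH; rewrite (pS (j + k)%N) /w; lra.
(* The 7 is 6 for the distance from [x] to [u n] plus 1 for the error of [H n]. *)
have Pub y n : P n y <= phi y + gamma * (Nm (y - x) + 7).
  apply: le_trans (_ : phi y + gamma * (1 - p n) * (Nm (y - x) + 7) <= _); last first.
    rewrite lerD2l ler_wpM2r ?addr_ge0//.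
    by have := mulr_gt0 g0 (p_gt0 n); lra.
  elim: n => [|n IH]; first by rewrite /= /p expr0 subrr mulr0 mul0r addr0.
  rewrite PS; have [_ /(_ (y - u n)) h1 _ _ _] := HP n.
  have h2 := xu n; have := sNm.1 (y - x) (x - u n); rewrite addrA subrK => h3.
  have p1 : p n <= 1 by rewrite exprn_ile1// ?invr_ge0// invf_le1 ?ler1n.
  have : w n * H n (y - u n) <= w n * (Nm (y - x) + 7) by rewrite ler_pM2l//; lra.
  by move: IH; rewrite (pS n) /w; lra.
pose V y := [set P n y | n in [set: nat]].
pose Phi y := sup (V y).
have Vub y z : V y z -> z <= phi y + gamma * (Nm (y - x) + 7).
  by move=> [n _ <-]; exact: Pub.
have Vne y : V y !=set0 by exists (P 0%N y), 0%N.
have Phi_ge n y : P n y <= Phi y by apply: sup_ge_mem (Vub y) _; exists n.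
have Phi_le b k y : (forall n, (k <= n)%N -> P n y <= b) -> Phi y <= b.
  move=> Pb; apply: ge_sup => // _ [n _ <-].
  by apply: le_trans (Pb _ (leq_maxl k n)); apply: Pmono; exact: leq_maxr.
have Phi_tail k y h : Phi (y + h) <= Phi y + P k (y + h) - P k y + gamma * p k * Nm h.
  apply: (@Phi_le _ k) => n kn; have := tail k n y h kn; have := Phi_ge n y.
  by have := mulr_ge0 (ltW (mulr_gt0 g0 (p_gt0 n))) (Nm0 h); lra.
exists Phi, x; split=> //.
- move=> v Av; apply/ler_addgt0Pr => e e0.
  (* The summands are the tail of the series at [x], the move from [u k] to [x] over a distance of
     at most [6 * p k], and the near-minimality of [u k]. *)
  pose K := 7 * gamma + (L + gamma) * 6 + gamma.
  have K0 : 0 < K by rewrite /K; lra.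
  have [|k ke] := @p_small (e / K); first by rewrite divr_gt0.
  rewrite ltr_pdivlMr// in ke.
  have h1 := umin k v Av; have h2 := Phi_ge k v.
  have p1 : p k <= 1 by rewrite exprn_ile1// ?invr_ge0// invf_le1 ?ler1n.
  have h3 : P k x <= P k (u k) + (L + gamma) * (6 * p k).
    have := tail 0%N k (u k) (x - u k) (leq0n k); rewrite subrKC.
    have := phiL (u k) (x - u k); rewrite subrKC p01 /= => h3 h4.
    have h5 : gamma * p k * Nm (x - u k) >= 0.
      by rewrite mulr_ge0// ltW// mulr_gt0.
    have : (L + gamma) * Nm (x - u k) <= (L + gamma) * (6 * p k).
      by rewrite ler_wpM2l// addr_ge0// ltW.
    by lra.
  have h4 n : (k <= n)%N -> P n x <= P k x + 7 * gamma * (p k - p n).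
    move=> /subnK <-; elim: (n - k)%N => [|j IH]; first by rewrite add0n subrr mulr0 addr0.
    rewrite addSn PS; have [_ /(_ (x - u (j + k)%N)) h5 _ _ _] := HP (j + k)%N.
    have h6 := xu (j + k)%N.
    have p1' : p (j + k)%N <= 1 by rewrite exprn_ile1// ?invr_ge0// invf_le1 ?ler1n.
    have : w (j + k)%N * H (j + k)%N (x - u (j + k)%N) <= w (j + k)%N * 7.
      by rewrite ler_pM2l//; lra.
    by move: IH; rewrite (pS (j + k)%N) /w; lra.
  have : Phi x <= P k x + 7 * gamma * p k.
    apply: (@Phi_le _ k) => n /h4; have := mulr_gt0 g0 (p_gt0 n); lra.
  have : w k * p k <= gamma * p k.
    rewrite ler_pM2r// /w -[leRHS]mulr1 ler_pM2l//.
    by rewrite exprn_ile1// ?invr_ge0// invf_le1 ?ler1n.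
  rewrite /K in ke; lra.
- have Pc n : convex_fun (P n).
    elim: n => [//|n IH]; have [_ _ _ Hc _] := HP n.
    exact: convex_funD IH (convex_fun_scale_shift (- u n) (w0 n) Hc).
  move=> s y z s0 s1; apply: ge_sup => // _ [n _ <-].
  apply: le_trans (Pc n s y z s0 s1) _.
  by apply: lerD; apply: ler_wpM2l; rewrite ?subr_ge0//; exact: Phi_ge.
- have Ps n : smooth_along (P n).
    elim: n => [//|n IH]; have [_ _ _ _ Hs] := HP n.
    exact: smooth_alongD IH (smooth_along_scale_shift (- u n) (w0 n) Hs).
  (* The tail after [k] is Lipschitz with constant [gamma * p k], so it adds at most [e / 2] to the
     second difference; the finite part is smooth. *)
  move=> y e e0; have [|k ke] := @p_small (e / (4 * gamma)).
    by rewrite divr_gt0// mulr_gt0.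
  rewrite ltr_pdivlMr ?mulr_gt0// in ke.
  have [|r r0 rP] := Ps k y (e / 2); first by lra.
  exists r => // h Yh hr; have := rP h Yh hr.
  have := Phi_tail k y h; have := Phi_tail k y (- h); rewrite (seminormN sNm).
  have : p k * (4 * gamma) * Nm h <= e * Nm h by rewrite ler_wpM2r// ltW.
  by lra.
- move=> y h; have := Phi_tail 0%N y h; rewrite p01 /=; lra.
Qed.

End SmoothVariationalPrinciple.

(** * Conormals relative to a set of directions *)

Section RelativeNormal.
Context {R : realType} {E : lmodType R}.
Implicit Types (f phi : E -> R) (A Y : set E).

(** The one-sided directional derivative, by convexity an infimum of difference quotients, is
    sublinear and so dominates a linear functional. *)
Lemma convex_subgradient phi x : convex_fun phi ->
  exists2 f, linear_fun f & forall h, f h <= phi (x + h) - phi x.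
Proof.
move=> cphi.
pose S h := [set (phi (x + t *: h) - phi x) / t | t in [set t : R | 0 < t]].
have Slb h z : S h z -> phi x - phi (x - h) <= z.
  move=> [t /= t0 <-]; rewrite ler_pdivlMr//.
  have t1 : 0 < 1 + t by lra.
  have := cphi (1 + t)^-1 (x + t *: h) (x - h).
  have -> : 1 - (1 + t)^-1 = t / (1 + t) by field; lra.
  have -> : (1 + t)^-1 *: (x + t *: h) + (t / (1 + t)) *: (x - h) = x.
    rewrite !scalerDr scalerA addrACA -scalerDl scalerN.
    rewrite [(1 + t)^-1 * t]mulrC subrr addr0.
    by rewrite -[X in (X + _) *: _]mul1r -mulrDl divff ?gt_eqF// scale1r.
  rewrite invr_ge0 ltW// invf_le1// lerDl ltW// => /(_ isT isT).
  rewrite [_^-1 * _]mulrC [t / _ * _]mulrAC -mulrDl ler_pdivlMr//; lra.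
have Sne h : S h !=set0 by exists ((phi (x + 1 *: h) - phi x) / 1), 1 => /=.
pose p h := inf (S h).
have ple h t : 0 < t -> p h <= (phi (x + t *: h) - phi x) / t.
  by move=> t0; apply: inf_le_mem (@Slb h) _; exists t.
have pZ s h : 0 < s -> p (s *: h) <= s * p h.
  move=> s0; rewrite -ler_pdivrMl//; apply: lb_le_inf => // _ [t /= t0 <-].
  rewrite ler_pdivrMl//; have := ple (s *: h) _ (divr_gt0 t0 s0).
  by rewrite scalerA divfK ?gt_eqF// invf_div mulrCA mulrA.
have sp : sublinear p.
  split=> [h k|s h s0].
    apply/ler_addgt0Pr => e e0.
    have [|_ [a /= a0 <-] ha] := inf_ltP (@Slb h) (Sne h)
      (_ : p h < p h + e / 2); first by lra.
    have [|_ [b /= b0 <-] hb] := inf_ltP (@Slb k) (Sne k)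
      (_ : p k < p k + e / 2); first by lra.
    have ab : 0 < a + b by rewrite addr_gt0.
    (* With this step length the point in direction [h + k] is the convex combination of
       [x + a *: h] and [x + b *: k] with weights [b / (a + b)] and [a / (a + b)]. *)
    have := ple (h + k) (a * b / (a + b)) (divr_gt0 (mulr_gt0 a0 b0) ab).
    have := cphi (b / (a + b)) (x + a *: h) (x + b *: k).
    have E1 : 1 - b / (a + b) = a / (a + b) by field; lra.
    rewrite E1.
    have -> : (b / (a + b)) *: (x + a *: h) + (a / (a + b)) *: (x + b *: k) =
        x + (a * b / (a + b)) *: (h + k).
      rewrite !scalerDr !scalerA addrACA -scalerDl -E1 subrKC scale1r.
      rewrite E1; congr (_ + (_ *: _ + _ *: _)); by ring.
    have l0 : 0 <= b / (a + b) by apply: divr_ge0; exact: ltW.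
    have l1 : b / (a + b) <= 1 by rewrite ler_pdivrMr// mul1r lerDr ltW.
    move=> /(_ l0 l1) h1 h2; apply: le_trans h2 _; rewrite ler_pdivrMr; last first.
      by rewrite divr_gt0// mulr_gt0.
    have -> : p h + p k + e = (p h + e / 2) + (p k + e / 2) by field.
    have : ((phi (x + a *: h) - phi x) / a + (phi (x + b *: k) - phi x) / b) *
        (a * b / (a + b)) = b / (a + b) * phi (x + a *: h) +
        a / (a + b) * phi (x + b *: k) - phi x by field; lra.
    move=> h3; apply: le_trans (_ : ((phi (x + a *: h) - phi x) / a +
      (phi (x + b *: k) - phi x) / b) * (a * b / (a + b)) <= _).
      by rewrite h3; lra.
    rewrite ler_pM2r; first by apply: lerD; exact: ltW.
    by rewrite divr_gt0// mulr_gt0.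
  apply/eqP; rewrite eq_le pZ//=; have := @pZ s^-1 (s *: h).
  rewrite scalerA mulVf ?gt_eqF// scale1r invr_gt0.
  by move=> /(_ s0); rewrite ler_pdivlMl.
have [f [lf fp _]] := hahn_banach 0 sp; exists f => // h.
by apply: le_trans (fp h) _; have := ple h 1 ltr01; rewrite scale1r divr1.
Qed.

(* [- f] is a Frechet normal to [A] at [x]. *)
Definition frechet_conormal (Nm : E -> R) A x f := forall e : R, 0 < e ->
  exists2 r, 0 < r & forall v, A v -> Nm (v - x) < r -> - (e * Nm (v - x)) <= f (v - x).

Definition smoothable (Nm : E -> R) Y (q : E -> R) := forall tau, 0 < tau ->
  exists G : E -> R, [/\ forall k, q k - tau <= G k, forall k, G k <= q k,
    forall k h, G (k + h) <= G k + q h, convex_fun G & smooth_along Nm Y G].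

(** The principle is applied to a smooth version of [q (v - v0 + b) + 3 * gamma * Nm (v - v0)]. One
    [gamma] absorbs the error in the hypothesis on [b], one the perturbation, and one keeps the
    minimiser near [v0]. The perturbation adds a fourth to the bound on [f]. *)
Lemma relative_conormal (Nm q : E -> R) Y A v0 b gamma eta :
  seminorm Nm -> seminorm q -> (forall k, q k <= Nm k) ->
  smoothable Nm Y q -> smoothable Nm Y Nm ->
  (forall v w, A v -> A w -> Y (v - w)) ->
  seq_complete (fun x y => Nm (x - y)) A -> A v0 -> 0 < gamma -> 0 < eta ->
  (forall v, A v -> q b <= q (v - v0 + b) + gamma * Nm (v - v0)) ->
  exists x f, [/\ A x /\ Nm (x - v0) <= eta, linear_fun f,
    forall h, f h <= q h + 4 * gamma * Nm h,
    q b - 4 * gamma * Nm b - eta <= f (x - v0 + b) &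
    frechet_conormal Nm A x f].
Proof.
move=> sNm sq qNm smq smN AY cA Av0 g0 eta0 Eb.
have Nm0 := seminorm_ge0 sNm.
pose K := (1 + 3 * gamma) * (1 + (1 + gamma) / gamma).
have K1 : 0 < 1 + 3 * gamma by lra.
have K2 : 0 < (1 + gamma) / gamma by rewrite divr_gt0//; lra.
have K0 : 0 < K by rewrite mulr_gt0//; lra.
pose tau := eta / K; have tau0 : 0 < tau by rewrite divr_gt0.
have tauK : tau * K = eta by rewrite /tau divfK// gt_eqF.
have [G [G1 G2 G3 G4 G5]] := smq tau tau0.
have [H [H1 H2 H3 H4 H5]] := smN tau tau0.
pose phi v := 1 * G (v + (b - v0)) + 3 * gamma * H (v - v0).
have g3 : 0 < 3 * gamma by lra.
have phiL x h : phi (x + h) - phi x <= q h + 3 * gamma * Nm h.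
  rewrite /phi !mul1r (addrAC x h (- v0)) (addrAC x h (b - v0)).
  have := G3 (x + (b - v0)) h; have := H3 (x - v0) h; rewrite -(ler_pM2l g3).
  by lra.
have phi_ge v : q (v - v0 + b) - tau + 3 * gamma * (Nm (v - v0) - tau) <= phi v.
  have := G1 (v + (b - v0)); have := H1 (v - v0); rewrite -(ler_pM2l g3).
  by rewrite /phi [b - v0]addrC addrA; lra.
have phiv0 : phi v0 <= q b.
  rewrite /phi subrr subrKC; have := G2 b; have := H2 0.
  rewrite (seminorm0 sNm) -(ler_pM2l g3); lra.
have phi_lb v : A v -> q b + 2 * gamma * Nm (v - v0) - (1 + 3 * gamma) * tau <= phi v.
  by move=> /Eb; have := phi_ge v; lra.
have [|||||||Phi [x [Ax xmin Pc Ps PL]]] := @smooth_variational_principle R E Nm sNm Y A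
   phi gamma (1 + 3 * gamma) (q b - (1 + 3 * gamma) * tau) _ cA g0.
- by exists v0.
- exact: ltW.
- by move=> x h; have := phiL x h; have := qNm h; lra.
- move=> v Av; have := phi_lb v Av.
  by have := mulr_ge0 (ltW g0) (Nm0 (v - v0)); lra.
- exact: convex_funD (convex_fun_scale_shift _ ltr01 G4) (convex_fun_scale_shift _ g3 H4).
- apply: smooth_alongD (smooth_along_scale_shift _ ltr01 G5) _.
  exact: smooth_along_scale_shift g3 H5.
- move=> t t0; have [H' [F1 F2 F3 F4 F5]] := smN t t0.
  exists (fun k => H' k + t); split=> [k|k|k h||k e e0].
  + by have := F1 k; lra.
  + by have := F2 k; lra.
  + by have := F3 k h; lra.
  + by move=> s y z s0 s1; have := F4 s y z s0 s1; lra.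
  + have [r r0 rP] := F5 k e e0; exists r => // h Yh hr.
    by have := rP h Yh hr; lra.
have xv0 : gamma * Nm (x - v0) <= (1 + 3 * gamma) * tau.
  have := PL x (v0 - x); rewrite subrKC (seminormB sNm v0).
  by have := xmin v0 Av0; have := phi_lb x Ax; lra.
have [f lf fP] := convex_subgradient x Pc.
set rho := Nm (x - v0) in xv0; have rhoE : rho = Nm (x - v0) by [].
clearbody rho.
have rhoK : (1 + gamma) * rho + (1 + 3 * gamma) * tau <= eta.
  rewrite -tauK /K; have : (1 + gamma) * rho <= (1 + gamma) / gamma * ((1 + 3 * gamma) * tau).
    rewrite -mulrA ler_pM2l; last by lra.
    by rewrite ler_pdivlMl.
  by lra.
have rho0 : 0 <= rho by rewrite rhoE.
exists x, f; split=> //.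
- split=> //; rewrite -rhoE; apply: le_trans rhoK.
  by have := mulr_ge0 (ltW g0) rho0; have := mulr_gt0 K1 tau0; lra.
- move=> h; have := fP h; have := PL x h; have := phiL x h; lra.
(* Stepping back from [x] to [v0 - b] brings the argument of [G] to 0, so the subgradient inequality
   bounds [f (x - v0 + b)] from below by almost [q b]. *)
- have := fP (- (x - v0 + b)); rewrite linN//; have := PL x (- (x - v0 + b)).
  have -> : x - (x - v0 + b) = v0 - b by rewrite !opprD !addrA subrr add0r opprK.
  rewrite (seminormN sNm).
  have : phi (v0 - b) <= 3 * gamma * Nm b.
    rewrite /phi addrA subrK subrr (addrAC v0) subrr add0r.
    have := G2 0; have := H2 (- b); rewrite (seminormN sNm) (seminorm0 sq).
    by rewrite -(ler_pM2l g3); lra.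
  have := phi_ge x; have := sq.1 (x - v0 + b) (v0 - x).
  rewrite addrAC addrA subrK subrr add0r.
  have := qNm (v0 - x); rewrite (seminormB sNm v0) -rhoE.
  have : gamma * Nm (x - v0 + b) <= gamma * (rho + Nm b).
    by rewrite ler_pM2l// rhoE; exact: sNm.1.
  have := mulr_ge0 (ltW g0) rho0; lra.
- move=> e e0; have [r r0 rP] := Ps x e e0; exists r => // v Av vr.
  have := rP (v - x) (AY _ _ Av Ax) vr; rewrite subrKC.
  have := fP (- (v - x)); rewrite linN//; have := xmin v Av; lra.
Qed.

End RelativeNormal.

(** * Reduction of Frechet normality to a separable set *)

Section SeparableReduction.
Context {R : realType} {E : lmodType R}.
Implicit Types (f : E -> R) (L : seq (R * nat * E)).

(** Each level contains the previous one and all values of the operations on it, so any two entries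
    can be lifted to a common level. *)
Lemma enum_closure (T : Type) (I : countType) (op : I -> T -> T -> T)
    (s : nat -> T) : exists e : nat -> T,
  (forall n, exists m, e m = s n) /\
  forall i a b, exists m, e m = op i (e a) (e b).
Proof.
pose next (g : nat -> T) n := match unpickle n : option (nat + I * nat * nat) with
  | Some (inr (i, a, b)) => op i (g a) (g b) | Some (inl a) => g a | None => g 0%N end.
pose lev := fix lev k := if k is j.+1 then next (lev j) else s.
have levS k a : exists m, lev k.+1 m = lev k a.
  by exists (pickle (inl a : nat + I * nat * nat)); rewrite /= /next pickleK.
have levD j k a : exists m, lev (j + k)%N m = lev k a.
  elim: j => [|j [m IH]]; first by exists a.
  by have [m' m'E] := levS (j + k)%N m; exists m'; rewrite addSn m'E.
pose e n := if unpickle n is Some (k, a) then lev k a else s 0%N.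
have eE k a : e (pickle (k, a)) = lev k a by rewrite /e pickleK.
have eP n : exists k a, e n = lev k a.
  rewrite /e; case: (unpickle n) => [[k a]|]; first by exists k, a.
  by exists 0%N, 0%N.
exists e; split=> [n|i a b]; first by exists (pickle (0%N, n)); rewrite eE.
have [k [a1 ->]] := eP a; have [l [b1 ->]] := eP b.
have [a2 <-] := levD l k a1; have [b2 <-] := levD k l b1; rewrite (addnC k l).
exists (pickle ((l + k).+1, pickle (inr (i, a2, b2) : nat + I * nat * nat))).
by rewrite eE /= /next pickleK.
Qed.

Variables (Nm q : E -> R) (sNm : seminorm Nm) (sq : seminorm q) (C : R).
Hypotheses (C0 : 0 <= C) (qN : forall x, q x <= C * Nm x).
Variables (Om : set E) (c0 : E) (beta : R).

Let Nm0 x : 0 <= Nm x := seminorm_ge0 sNm x.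

(** A triple [(t, m, v)] of [L] is the inequality [- (harm m * Nm (v - x)) <= g (v - x)] with
    multiplier [t]. By duality, a linear [g <= q] with [beta <= g (x - c0)] that satisfies a family
    of them exists exactly when [beta <= val x L] for all finite combinations [L]. *)
Let shift x L := \sum_(l <- L) l.1.1 *: (l.2 - x).
Let cost x L := \sum_(l <- L) l.1.1 * harm l.1.2 * Nm (l.2 - x).
Let weight L := \sum_(l <- L) l.1.1.
Let val x L := q (x - c0 + shift x L) + cost x L.

Let adm (P : set E) x (r : nat -> R) L := forall l, l \in L ->
  [/\ 0 <= l.1.1, P l.2 & Nm (l.2 - x) < r l.1.2].

Let harm_le1 n : harm n <= 1 :> R.
Proof. by have := @le_harm R 0 n isT; rewrite /harm invr1. Qed.

(** Bounded weights make [val] Lipschitz in the base point, so a base point in [Y] may be replaced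
    by a nearby term of the enumeration. *)
Let val_lip P x d r L (t : R) : adm P x r L -> weight L <= t ->
  val d L <= val x L + (C * (1 + t) + t) * Nm (d - x).
Proof.
move=> aL wt.
have w0 : 0 <= weight L.
  by rewrite /weight big_seq sumr_ge0// => l /aL[].
rewrite /val; have -> : d - c0 + shift d L = x - c0 + shift x L + (1 - weight L) *: (d - x).
  rewrite scalerBl scale1r /shift /weight scaler_suml.
  have -> : \sum_(l <- L) l.1.1 *: (l.2 - d) =
      \sum_(l <- L) l.1.1 *: (l.2 - x) - \sum_(l <- L) l.1.1 *: (d - x).
    rewrite -sumrB; apply: eq_bigr => l _; rewrite -scalerBr opprB.
    by rewrite addrA subrK.
  have aux S : d - c0 + S = x - c0 + S + (d - x).
    by rewrite -[x - c0 + S]addrA [x + _]addrC -[RHS]addrA subrKC [RHS]addrC addrA.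
  by rewrite addrA aux [RHS]addrA.
have h1 : q (x - c0 + shift x L + (1 - weight L) *: (d - x)) <=
    q (x - c0 + shift x L) + C * (1 + t) * Nm (d - x).
  apply: le_trans (sq.1 _ _) _; rewrite lerD2l sq.2 -mulrA mulrCA.
  apply: le_trans (_ : (1 + t) * q (d - x) <= _).
    apply: ler_wpM2r; first exact: seminorm_ge0.
    by apply: le_trans (ler_normB _ _) _; rewrite normr1 ger0_norm// lerD2l.
  by rewrite ler_wpM2l//; lra.
have h2 : cost d L <= cost x L + t * Nm (d - x).
  apply: le_trans (_ : cost x L + weight L * Nm (d - x) <= _); last first.
    by rewrite lerD2l ler_wpM2r.
  rewrite /cost /weight mulr_suml -big_split/= big_seq [leRHS]big_seq.
  apply: ler_sum => l /aL[l0 _ _]; rewrite -!mulrA -mulrDr.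
  apply: ler_wpM2l => //.
  have h3 : Nm (l.2 - d) <= Nm (l.2 - x) + Nm (d - x).
    have := sNm.1 (l.2 - x) (x - d); rewrite addrA subrK.
    by rewrite (seminormB sNm x).
  have := ler_wpM2l (ltW (@harm_gt0 R l.1.2)) h3; rewrite mulrDr => h4.
  apply: le_trans h4 _; rewrite lerD2l -[leRHS]mul1r.
  by apply: ler_wpM2r.
by lra.
Qed.

(** A violating combination, graded by countable data: a finite list of radius indices, a bound on
    the weights, and a deficit. Radius 0 past the end of the list excludes those accuracies. *)
Let bad x (w : seq nat * nat * nat) L :=
  [/\ adm Om x (fun m => if (m < size w.1.1)%N
        then 3 / 4 * harm (nth 0%N w.1.1 m) else 0) L,
      weight L <= w.1.2%:R & val x L < beta - harm w.2].

Lemma separable_reduction (s : nat -> E) : exists e : nat -> E,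
  [/\ forall n, exists m, e m = s n, forall a b, exists m, e m = e a - e b &
  let Y := [set x | forall r : R, 0 < r -> exists n, Nm (x - e n) < r] in
  forall x f, Y x -> linear_fun f -> (forall h, f h <= q h) ->
    beta <= f (x - c0) -> frechet_conormal Nm (Om `&` Y) x f ->
    exists g, [/\ linear_fun g, forall h, g h <= q h, beta <= g (x - c0) &
      frechet_conormal Nm Om x g]].
Proof.
have /choice[W WP] : forall xw : E * (seq nat * nat * nat), exists L,
    (exists L, bad xw.1 xw.2 L) -> bad xw.1 xw.2 L.
  move=> [x w] /=; have [[L bL]|nL] := pselect (exists L, bad x w L).
    by exists L.
  by exists [::].
(* The enumeration is closed under differences and under taking the points of the chosen violating
   combination at each of its terms. *)
pose op (i : unit + (seq nat * nat * nat) * nat) x y := match i with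
  | inl _ => x - y | inr (w, k) => (nth (0, 0%N, x) (W (x, w)) k).2 end.
have [e [es ecl]] := enum_closure op s.
exists e; split=> // [a b|Y x f Yx lf fq fb fN]; first exact: ecl (inl tt) a b.
have /choice[al alP] : forall m, exists k, forall v, (Om `&` Y) v ->
    Nm (v - x) < harm k -> - (harm m * Nm (v - x)) <= f (v - x).
  move=> m; have [r r0 rP] := fN _ (@harm_gt0 R m); have [k kr] := harm_lt r0.
  by exists k => v Av vk; apply: rP Av (lt_trans vk kr).
have rel L : adm (Om `&` Y) x (fun m => harm (al m)) L -> beta <= val x L.
  move=> aL; apply: le_trans fb _; rewrite /val.
  apply: le_trans (_ : f (x - c0 + shift x L) + cost x L <= _); last first.
    by rewrite lerD2r.
  rewrite (linD (x - c0) _ lf) -addrA lerDl /shift /cost; elim: L aL => [_|l L IH aL].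
    by rewrite !big_nil (lin0 lf) addr0.
  rewrite !big_cons (linD _ _ lf) (linZ _ _ lf) addrACA addr_ge0//.
    have [l0 Al lx] := aL l (mem_head _ _).
    have := ler_wpM2l l0 (alP _ _ Al lx); lra.
  by apply: IH => k kL; apply: aL; rewrite inE kL orbT.
(* Otherwise [L] is bad at some nearby term [d], and so is the chosen combination there, whose
   points lie in [Y]; seen from [x] it contradicts [rel]. The radii pass from 1/2 over 3/4 to 1
   times [harm (al m)], a quarter for each change of base point, and [harm j] likewise pays for each
   change in [val]. *)
have full L : adm Om x (fun m => 2^-1 * harm (al m)) L -> beta <= val x L.
  move=> aL; rewrite leNgt; apply/negP => vb.
  have [N LN] : exists N, forall l, l \in L -> (l.1.2 < N)%N.
    exists (\max_(l <- L) l.1.2).+1 => l lL.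
    by rewrite ltnS; exact: (leq_bigmax_seq (F := fun l => l.1.2)).
  have [a aS aE] : exists2 a, size a = N & forall m, (m < N)%N -> nth 0%N a m = al m.
    by exists (mkseq al N); [rewrite size_mkseq|move=> m mN; rewrite nth_mkseq].
  pose K := \max_(m < N) al m.
  have alK m : (m < N)%N -> harm K <= harm (al m) :> R.
    by move=> mN; apply: le_harm; exact: (@leq_bigmax _ (fun m : 'I_N => al m) (Ordinal mN)).
  have [T wT] : exists T : nat, weight L <= T%:R.
    exists (Num.truncn (weight L)).+1; apply: ltW; exact: truncnS_gt.
  have [|j jP] := @harm_lt R ((beta - val x L) / 2); first by lra.
  pose cst := C * (1 + T%:R) + T%:R + 1 : R.
  have cst0 : 0 < cst by rewrite ltr_wpDl// addr_ge0// mulr_ge0// addr_ge0.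
  have [|n xn] := Yx (Num.min (harm K / 4) (harm j / cst)).
    by rewrite lt_min !divr_gt0// harm_gt0.
  move: xn; rewrite lt_min => /andP[xn1 xn2].
  set d := e n in xn1 xn2.
  have lip : (C * (1 + T%:R) + T%:R) * Nm (x - d) <= harm j.
    move: xn2; rewrite ltr_pdivlMr// => /ltW; apply: le_trans.
    by rewrite mulrC ler_wpM2l// /cst lerDl.
  have bd : bad d (a, T, j) L.
    split=> //=; last first.
      by have := val_lip d aL wT; rewrite (seminormB sNm); lra.
    move=> l lL; have [l0 Ol lx] := aL l lL; split=> //.
    rewrite /= aS LN// aE ?LN//; have := alK _ (LN _ lL).
    have := sNm.1 (l.2 - x) (x - d); rewrite addrA subrK; lra.
  have [aL' wL' vL'] : bad d (a, T, j) (W (d, (a, T, j))).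
    by apply: (WP (d, (a, T, j))); exists L.
  set L' := W _ in aL' wL' vL'.
  have : beta <= val x L'.
    apply: rel => l lL'; have [l0 Ol] := aL' l lL'.
    rewrite /= aS; case: ltnP => [lN|_ h]; last first.
      by have := Nm0 (l.2 - d); rewrite leNgt h.
    rewrite aE// => ld; split=> //; last first.
      have := alK _ lN; have := sNm.1 (l.2 - d) (d - x); rewrite addrA subrK.
      by rewrite (seminormB sNm d); lra.
    split=> // r r0; have [m mE] := ecl (inr ((a, T, j), index l L')) n n.
    exists m; rewrite mE /op -/d -/L' nth_index// subrr.
    by rewrite (seminorm0 sNm).
  by have := val_lip x aL' wL'; lra.
(* A convex cone, since lists concatenate and weights rescale; lists with a single triple return the
   conormal inequalities. *)
pose CC := [set y | exists2 L, adm Om x (fun m => 2^-1 * harm (al m)) L &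
  y = (shift x L, cost x L)].
have [|||||||g [lg gq gC gb]] := @hahn_banach_cone _ _ q CC (x - c0) beta.
- exact: seminorm_sublinear.
- exact: seminorm_ge0.
- by exists [::] => //; rewrite /shift /cost !big_nil.
- move=> _ _ [L1 a1 ->] [L2 a2 ->]; exists (L1 ++ L2); last first.
    by rewrite /shift /cost !big_cat.
  by move=> l; rewrite mem_cat => /orP[/a1|/a2].
- move=> t _ t0 [L aL ->] /=; exists [seq (t * l.1.1, l.1.2, l.2) | l <- L].
    move=> _ /mapP[l lL ->] /=; have [l0 Ol lx] := aL l lL.
    by split=> //; rewrite mulr_ge0// ltW.
  rewrite /shift /cost !big_map scaler_sumr mulr_sumr; congr (_, _).
    by apply: eq_bigr => l _; rewrite scalerA.
  by apply: eq_bigr => l _; rewrite !mulrA.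
- move=> _ [L aL ->] /=; rewrite /cost big_seq sumr_ge0// => l /aL[l0 _ _].
  by rewrite !mulr_ge0// ltW// harm_gt0.
- by move=> _ [L aL ->] /=; exact: full.
exists g; split=> // r r0; have [m mr] := harm_lt r0.
exists (2^-1 * harm (al m)); first by rewrite mulr_gt0// harm_gt0.
move=> v Ov vx; have := gC (shift x [:: (1, m, v)], cost x [:: (1, m, v)]) _.
rewrite /= /shift /cost !big_seq1 /= scale1r mul1r => h.
apply: le_trans (h _); last first.
  exists [:: (1, m, v)]; last by rewrite /shift /cost !big_seq1 /= scale1r mul1r.
  by move=> l; rewrite inE => /eqP->.
by rewrite lerN2 ler_wpM2r// ltW.
Qed.

End SeparableReduction.

(** * Existence of conormals in the separable-dual and convex cases *)

Section ConormalExistence.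
Context {R : realType} {E : lmodType R}.
Variables (Nm q : E -> R).
Hypotheses (sNm : seminorm Nm) (sq : seminorm q) (qNm : forall k, q k <= Nm k).
Implicit Types (f : E -> R) (s : nat -> E).

Let Nm0 x : 0 <= Nm x := seminorm_ge0 sNm x.

(** The net is only bounded by [M * p]: on a product it consists of sums over the coordinates. *)
Definition separable_dual (p : E -> R) := forall s, exists (c : nat -> E -> R) (M : R),
  [/\ 0 <= M, forall j, linear_fun (c j), forall j h, `|c j h| <= M * p h &
  forall f e, polar p f -> 0 < e -> exists j, forall i, `|f (s i) - c j (s i)| <= e * p (s i)].

Lemma smoothable_closure (p : E -> R) s : separable_dual Nm -> seminorm p ->
  (forall k, p k <= Nm k) ->
  let Y := [set x | forall r : R, 0 < r -> exists n, Nm (x - s n) < r] in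
  Y 0 -> smoothable Nm Y p.
Proof.
move=> sd sp pN Y Y0 tau tau0; have [c [M [M0 cl cM cd]]] := sd s.
have M1 : 0 < 1 + M by lra.
have [|||G [G1 G2 G3 G4 G5]] := @smooth_approximation R E Nm p Y c (1 + M)
    (tau / (1 + M) ^+ 2) sNm sp pN Y0 M1 _ cl.
- by rewrite divr_gt0// exprn_gt0.
- move=> f j h pf; apply: le_trans (ler_normB _ _) _; rewrite mulrDl mul1r.
  by rewrite lerD//; exact: polar_norm.
- move=> f e pf e0; have [j jP] := cd f e pf e0; exists j => h Yh.
  apply/ler_addgt0Pr => r r0.
  have B0 : 0 < e + (1 + M) by lra.
  have [|n nP] := Yh (r / (e + (1 + M))); first by rewrite divr_gt0.
  move: nP; rewrite ltr_pdivlMr// => nP.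
  have := jP n; have := polar_norm sNm (h - s n) pf; have := cM j (h - s n).
  have -> : f h - c j h = (f (s n) - c j (s n)) + f (h - s n) - c j (h - s n).
    by rewrite (linB _ _ pf.1) (linB _ _ (cl j)); ring.
  have := sNm.1 (s n - h) h; rewrite subrK (seminormB sNm (s n)) => h1 h2 h3 h4.
  have : e * Nm (s n) <= e * (Nm (h - s n) + Nm h) by rewrite ler_pM2l.
  have := ler_normB (f (s n) - c j (s n) + f (h - s n)) (c j (h - s n)).
  have := ler_normD (f (s n) - c j (s n)) (f (h - s n)).
  by lra.
exists G; split=> // k; have := G1 k.
by rewrite divfK// gt_eqF// exprn_gt0.
Qed.

Variables (Om : set E) (v0 b : E) (gamma : R).
Hypotheses (Ov0 : Om v0) (g0 : 0 < gamma).
Hypothesis Om_min : forall v, Om v -> q b <= q (v - v0 + b) + gamma * Nm (v - v0).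

Let qg h := q h + 4 * gamma * Nm h.

Let sqg : seminorm qg.
Proof.
split=> [x y|t x]; rewrite /qg.
  have : 4 * gamma * Nm (x + y) <= 4 * gamma * (Nm x + Nm y).
    by rewrite ler_pM2l ?sNm.1// mulr_gt0.
  by have := sq.1 x y; lra.
by rewrite sq.2 sNm.2; ring.
Qed.

Definition conormal_at (eta : R) (x : E) (f : E -> R) :=
  [/\ Om x /\ Nm (x - v0) <= eta, linear_fun f,
    forall h, f h <= q h + 4 * gamma * Nm h,
    q b - 4 * gamma * Nm b - eta <= f (x - v0 + b) &
    frechet_conormal Nm Om x f].

Lemma conormal_exists_separable_dual eta : 0 < eta -> separable_dual Nm ->
  seq_complete (fun x y => Nm (x - y)) Om -> exists x f, conormal_at eta x f.
Proof.
move=> eta0 sd cOm.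
pose s n := if n is 0 then v0 else v0 - b.
have qgN h : qg h <= (1 + 4 * gamma) * Nm h by rewrite /qg; have := qNm h; lra.
have C0 : 0 <= 1 + 4 * gamma by have := g0; lra.
have [e [es eB eP]] := separable_reduction sNm sqg C0 qgN Om (v0 - b)
  (q b - 4 * gamma * Nm b - eta) s.
set Y := [set x | forall r, _ -> exists n, _] in eP.
have Ye n : Y (e n) by move=> r r0; exists n; rewrite subrr (seminorm0 sNm).
have YB x y : Y x -> Y y -> Y (x - y).
  move=> Yx Yy r r0; have [|n nP] := Yx (r / 2); first by lra.
  have [|m mP] := Yy (r / 2); first by lra.
  have [k kE] := eB n m; exists k; rewrite kE.
  have -> : x - y - (e n - e m) = (x - e n) - (y - e m).
    by rewrite !opprD !opprK addrACA.
  by have := sNm.1 (x - e n) (- (y - e m)); rewrite (seminormN sNm); lra.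
have Yv0 : Y (s 0%N) by have [n <-] := es 0%N; exact: Ye.
have Y0 : Y 0 by rewrite -(subrr v0); exact: YB.
have cA : seq_complete (fun x y => Nm (x - y)) (Om `&` Y).
  move=> u uA uc; have [|x Ox ux] := cOm u _ uc; first by move=> n; have [] := uA n.
  exists x => //; split=> // r r0; have [|N NP] := ux (r / 2); first by lra.
  have [_ /(_ (r / 2))[|m mP]] := uA N; first by lra.
  exists m; have := NP N (leqnn _); rewrite (seminormB sNm).
  by have := sNm.1 (x - u N) (u N - e m); rewrite addrA subrK; lra.
have [|||||x [f [[[Ox Yx] xv] lf fq fb fN]]] := @relative_conormal R E Nm q Y
    (Om `&` Y) v0 b gamma eta sNm sq qNm _ _ _ cA _ g0 eta0.
- exact: smoothable_closure.
- exact: smoothable_closure.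
- by move=> v w [_ Yv] [_ Yw]; exact: YB.
- by split.
- by move=> v [Ov _]; exact: Om_min.
have E1 : x - (v0 - b) = x - v0 + b by rewrite opprB addrCA addrC.
have [|g [lg gq gb gN]] := eP x f Yx lf fq _ fN; first by rewrite E1.
by exists x, g; split=> //; rewrite -E1.
Qed.

(** Here [x = v0] works: the minimality extends to the cone generated by [Om - v0], and the
    functional found is nonnegative on that cone. *)
Lemma conormal_exists_convex eta : 0 < eta ->
  (forall (t : R) x y, 0 <= t -> t <= 1 -> Om x -> Om y -> Om (t *: x + (1 - t) *: y)) ->
  exists x f, conormal_at eta x f.
Proof.
move=> eta0 cvx.
(* For [t <= 1] by convexity; for [t > 1] multiply the inequality by [t] and split off
   [(t - 1) * q b] by the triangle inequality. *)
have ray t v : 0 <= t -> Om v ->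
    q b <= q (b + t *: (v - v0)) + gamma * Nm (t *: (v - v0)).
  move=> t0 Ov; have [t1|t1] := leP t 1.
    have := Om_min (cvx t v v0 t0 t1 Ov Ov0).
    have -> : t *: v + (1 - t) *: v0 - v0 = t *: (v - v0).
      by rewrite scalerBl scale1r scalerBr addrCA [v0 + _]addrC addrK.
    by rewrite [b + _]addrC.
  have t00 : 0 < t by lra.
  have := Om_min Ov; rewrite sNm.2 ger0_norm// => h1.
  have := sq.1 (b + t *: (v - v0)) ((t - 1) *: b).
  have -> : b + t *: (v - v0) + (t - 1) *: b = t *: (v - v0 + b).
    by rewrite scalerBl scale1r [b + _]addrC -addrA subrKC -scalerDr.
  have -> : q ((t - 1) *: b) = (t - 1) * q b.
    by rewrite sq.2 ger0_norm// subr_ge0 ltW.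
  rewrite sq.2 ger0_norm//; have := h1; rewrite -(ler_pM2l t00); lra.
pose C := [set y : E * R | exists t v, [/\ 0 <= t, Om v & y = (t *: (v - v0), 0)]].
have [|||||||f [lf fq fC fb]] := @hahn_banach_cone _ _ qg C b (q b - 4 * gamma * Nm b - eta).
- exact: seminorm_sublinear.
- exact: seminorm_ge0.
- by exists 0, v0; split=> //; rewrite scale0r.
- move=> _ _ [t1 [x1 [t10 Ox1 ->]]] [t2 [x2 [t20 Ox2 ->]]].
  have [t120|t12] := eqVneq (t1 + t2) 0.
    have [-> ->] : t1 = 0 /\ t2 = 0 by split; lra.
    by exists 0, v0; split=> //; rewrite !scale0r /= ; congr (_, _); rewrite addr0.
  have t12_gt0 : 0 < t1 + t2 by rewrite lt_neqAle eq_sym t12 addr_ge0.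
  exists (t1 + t2), (t1 / (t1 + t2) *: x1 + (1 - t1 / (t1 + t2)) *: x2).
  split; first exact: ltW.
    apply: cvx => //; first by rewrite divr_ge0// ltW.
    by rewrite ler_pdivrMr// mul1r lerDl.
  congr (_, _); last by rewrite addr0.
  have -> : 1 - t1 / (t1 + t2) = t2 / (t1 + t2) by field; lra.
  rewrite /= [RHS]scalerBr [X in _ = X - _]scalerDr !scalerA !(mulrC (t1 + t2)) !divfK//.
  by rewrite !scalerBr scalerDl opprD addrACA.
- move=> s _ s0 [t [v [t0 Ov ->]]] /=; exists (s * t), v; split=> //.
    by rewrite mulr_ge0// ltW.
  by rewrite scalerA mulr0.
- by move=> _ [t [v [_ _ ->]]].
- move=> _ [t [v [t0 Ov ->]]] /=; rewrite addr0 /qg; have := ray t v t0 Ov.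
  have := sNm.1 (b + t *: (v - v0)) (- b); rewrite addrAC subrr add0r (seminormN sNm).
  rewrite -(ler_pM2l g0) => h1 h2.
  have := mulr_ge0 (ltW g0) (Nm0 b); have := mulr_ge0 (ltW g0) (Nm0 (b + t *: (v - v0))).
  by lra.
exists v0, f; rewrite /conormal_at subrr (seminorm0 sNm) add0r; split=> //.
  by split=> //; exact: ltW.
move=> r r0; exists 1 => // v Ov _.
have := fC (v - v0, 0) _; rewrite /= oppr0 => h.
apply: le_trans (h _); first by rewrite oppr_le0 mulr_ge0// ltW.
by exists 1, v; split=> //; rewrite scale1r.
Qed.

End ConormalExistence.

(** * The maximum norm and coordinates of functionals *)

Section MaxNorm.
Context {R : realType} {X : normedModType R} {n : nat}.
Implicit Types (x y : 'I_n -> X) (f : ('I_n -> X) -> R).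

Lemma max_norm_ge x i : `|x i| <= max_norm x.
Proof. by rewrite /max_norm (bigD1 i)//= le_max lexx. Qed.

Lemma max_norm_ge0 x : 0 <= max_norm x.
Proof.
rewrite /max_norm; elim/big_ind : _ => // y z y0 z0.
by rewrite le_max y0.
Qed.

Lemma max_norm_le x c : 0 <= c -> (forall i, `|x i| <= c) -> max_norm x <= c.
Proof.
move=> c0 xc; rewrite /max_norm; elim/big_ind : _ => // y z yc zc.
by rewrite ge_max yc.
Qed.

Lemma max_norm_seminorm : seminorm (@max_norm R X n).
Proof.
split=> [x y|t x].
  apply: max_norm_le => [|i]; first by rewrite addr_ge0// max_norm_ge0.
  by apply: le_trans (ler_normD _ _) _; rewrite lerD// max_norm_ge.
have le s y : max_norm (s *: y) <= `|s| * max_norm y.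
  apply: max_norm_le => [|i]; first by rewrite mulr_ge0// max_norm_ge0.
  rewrite [(s *: y) i](_ : _ = s *: y i)// normrZ.
  by rewrite ler_wpM2l// max_norm_ge.
apply/eqP; rewrite eq_le le/=; have [->|t0] := eqVneq t 0.
  by rewrite normr0 mul0r max_norm_ge0.
rewrite -ler_pdivlMl ?normr_gt0//; have := le t^-1 (t *: x).
by rewrite scalerA mulVf// scale1r normfV.
Qed.

Lemma max_norm_gt0 x : x <> 0 -> 0 < max_norm x.
Proof.
move=> x0; rewrite lt_neqAle max_norm_ge0 andbT eq_sym; apply/eqP => N0.
apply: x0; apply/funext => i; apply/eqP; rewrite -normr_le0.
by have := max_norm_ge x i; rewrite N0.
Qed.

Definition single i (h : X) : 'I_n -> X := fun j => if j == i then h else 0.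

Lemma singleD i : {morph single i : g h / g + h}.
Proof.
move=> g h; apply/funext => j; rewrite /single !fctE.
by case: ifP => // _; rewrite addr0.
Qed.

Lemma singleZ i (t : R) h : single i (t *: h) = t *: single i h.
Proof.
apply/funext => j; rewrite /single !fctE; by case: ifP => // _; rewrite scaler0.
Qed.

Lemma max_norm_single i h : max_norm (single i h) = `|h|.
Proof.
apply/eqP; rewrite eq_le; apply/andP; split.
  by apply: max_norm_le => // j; rewrite /single; case: ifP => // _; rewrite normr0.
by have := max_norm_ge (single i h) i; rewrite /single eqxx.
Qed.

Lemma sum_single x : x = \sum_(i < n) single i (x i).
Proof.
apply/funext => j; rewrite fct_sumE (bigD1 j)//= {1}/single eqxx big1 ?addr0//.
by move=> i ij; rewrite /single eq_sym (negbTE ij).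
Qed.

Lemma lin_sum f (I : Type) (r : seq I) (F : I -> 'I_n -> X) : linear_fun f ->
  f (\sum_(i <- r) F i) = \sum_(i <- r) f (F i).
Proof.
move=> lf; elim: r => [|i r IH]; first by rewrite !big_nil lin0.
by rewrite !big_cons linD// IH.
Qed.

Lemma lin_single f i : linear_fun f -> linear_fun (fun h => f (single i h)).
Proof.
move=> lf; apply: linear_funP => [g h|t h]; first by rewrite singleD linD.
by rewrite singleZ linZ.
Qed.

Lemma lin_decomp f x : linear_fun f -> f x = \sum_(i < n) f (single i (x i)).
Proof. by move=> lf; rewrite {1}[x]sum_single lin_sum. Qed.

End MaxNorm.

(** * The dual norm *)

Section DualNorm.
Context {R : realType} {X : normedModType R}.
Implicit Types f : X -> R.

Lemma lin_bounded_dual f c : linear_fun f -> (forall h, f h <= c * `|h|) ->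
  dual_space (f : X -> R^o).
Proof.
move=> lf fc; split=> // x; apply/cvgrPdist_le => /= e e0.
have c1 : 0 < `|c| + 1 by rewrite ltr_wpDl.
near=> y; rewrite -linB//.
have xy : `|x - y| <= e / (`|c| + 1).
  by near: y; apply: cvgr_dist_le => //; rewrite divr_gt0.
rewrite ler_pdivlMr// in xy.
have fa h : f h <= (`|c| + 1) * `|h|.
  apply: le_trans (fc h) _; apply: ler_wpM2r => //.
  by apply: le_trans (ler_norm c) _; rewrite lerDl.
have := fa (x - y); have := fa (- (x - y)); rewrite (linN _ lf) normrN.
by rewrite ler_norml; lra.
Unshelve. all: by end_near. Qed.

Lemma dual_bounded f : dual_space (f : X -> R^o) ->
  exists2 c, 0 <= c & forall h, `|f h| <= c * `|h|.
Proof.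
move=> [lf cf]; have f0 := lin0 lf.
have /cvgrPdist_le /(_ 1 ltr01) := cf 0; rewrite f0 => /nbhs_ballP[r /= r0 rP].
exists (2 / r); first by rewrite divr_ge0// ltW.
move=> h; have [->|h0] := eqVneq h 0; first by rewrite f0 !normr0 mulr0.
have hn : 0 < `|h| by rewrite normr_gt0.
have : ball (0 : X) r ((r / (2 * `|h|)) *: h).
  rewrite -ball_normE /ball_/= sub0r normrN normrZ ger0_norm ?divr_ge0 ?mulr_ge0 ?(ltW r0)//.
  have -> : r / (2 * `|h|) * `|h| = r / 2 by field; rewrite gt_eqF.
  by lra.
move=> /rP /=; rewrite sub0r normrN (linZ _ _ lf) normrM.
rewrite ger0_norm ?divr_ge0 ?mulr_ge0 ?(ltW r0)// mulrAC ler_pdivrMr ?mulr_gt0// mul1r.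
by rewrite -ler_pdivlMl// => /le_trans; apply; rewrite mulrA [r^-1 * _]mulrC.
Qed.

Let vals f := [set `|f x| | x in [set x : X | `|x| <= 1]].

Let vals_ne f : vals f !=set0.
Proof. by exists `|f 0|, 0 => //=; rewrite normr0. Qed.

Lemma dual_norm_ge f h : dual_space (f : X -> R^o) ->
  `|f h| <= dual_norm (f : X -> R^o) * `|h|.
Proof.
move=> df; have [c c0 fc] := dual_bounded df; case: df => lf _.
have [->|h0] := eqVneq h 0; first by rewrite (lin0 lf) !normr0 mulr0.
have hn : 0 < `|h| by rewrite normr_gt0.
rewrite -ler_pdivrMr//; apply: (@sup_ge_mem _ _ c).
  move=> _ [x /= x1 <-]; apply: le_trans (fc x) _.
  by rewrite -[leRHS]mulr1 ler_wpM2l.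
exists (`|h|^-1 *: h) => /=; last by rewrite (linZ _ _ lf) normrM normfV normr_id mulrC.
by rewrite normrZ normfV normr_id mulVf// gt_eqF.
Qed.

Lemma dual_norm_le f c : 0 <= c -> (forall h, `|f h| <= c * `|h|) ->
  dual_norm (f : X -> R^o) <= c.
Proof.
move=> c0 fc; apply: ge_sup (vals_ne f) _ => _ [x /= x1 <-]; apply: le_trans (fc x) _.
by rewrite -[leRHS]mulr1 ler_wpM2l.
Qed.

Lemma dual_norm_ge0 f : dual_space (f : X -> R^o) -> 0 <= dual_norm (f : X -> R^o).
Proof.
move=> df; have [c c0 fc] := dual_bounded df; apply: (@sup_ge_mem _ _ c).
  move=> _ [x /= x1 <-]; apply: le_trans (fc x) _.
  by rewrite -[leRHS]mulr1 ler_wpM2l.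
by exists 0; rewrite /= ?normr0// (lin0 df.1) normr0.
Qed.

Lemma dual_norm_near f e : dual_space (f : X -> R^o) -> 0 < e ->
  exists2 h, `|h| <= 1 & dual_norm (f : X -> R^o) - e < f h.
Proof.
move=> df e0; have [c c0 fc] := dual_bounded df.
have [||_ [h /= h1 <-] hP] := @sup_gtP _ (vals f) c (dual_norm (f : X -> R^o) - e) _ (vals_ne f).
- move=> _ [x /= x1 <-]; apply: le_trans (fc x) _.
  by rewrite -[leRHS]mulr1 ler_wpM2l.
- by rewrite /dual_norm; lra.
have [f0|f0] := leP 0 (f h); first by exists h; rewrite // -(ger0_norm f0).
by exists (- h); rewrite ?normrN// (linN _ df.1) -(ltr0_norm f0).
Qed.

Lemma dual_space0 : dual_space (0 : X -> R^o).
Proof.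
have -> : (0 : X -> R^o) = fun=> 0 by [].
apply: (@lin_bounded_dual _ 0) => [|h]; last by rewrite mul0r.
by apply: linear_funP => [x y|t x]; rewrite ?addr0 ?mulr0.
Qed.

Lemma dual_spaceD f g : dual_space (f : X -> R^o) -> dual_space (g : X -> R^o) ->
  dual_space (f + g : X -> R^o).
Proof.
move=> df dg; have [a a0 fa] := dual_bounded df; have [b b0 gb] := dual_bounded dg.
apply: (@lin_bounded_dual _ (a + b)) => [|h].
  apply: linear_funP => [x y|t x]; rewrite !fctE.
    by rewrite (linD _ _ df.1) (linD _ _ dg.1) addrACA.
  by rewrite (linZ _ _ df.1) (linZ _ _ dg.1) mulrDr.
rewrite !fctE mulrDl; have := fa h; have := gb h; rewrite !ler_norml; lra.
Qed.

Lemma dual_space_sum (I : Type) (r : seq I) (F : I -> X -> R^o) :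
  (forall i, dual_space (F i)) -> dual_space (\sum_(i <- r) F i).
Proof.
move=> dF; elim: r => [|i r IH]; first by rewrite big_nil; exact: dual_space0.
by rewrite big_cons; exact: dual_spaceD.
Qed.

Lemma dual_normZ f t : dual_space (f : X -> R^o) ->
  dual_norm (t *: (f : X -> R^o)) = `|t| * dual_norm (f : X -> R^o).
Proof.
move=> df; have dn0 := dual_norm_ge0 df.
have dft : dual_space (t *: (f : X -> R^o)).
  have [a a0 fa] := dual_bounded df.
  apply: (@lin_bounded_dual _ (`|t| * a)) => [|h].
    apply: linear_funP => [x y|s x]; rewrite !fctE.
      by rewrite (linD _ _ df.1) scalerDr.
    by rewrite (linZ _ _ df.1) /GRing.scale/=; ring.
  apply: le_trans (ler_norm _) _; rewrite !fctE normrM -mulrA.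
  by rewrite ler_wpM2l.
apply/eqP; rewrite eq_le; apply/andP; split.
  apply: dual_norm_le => [|h]; first by rewrite mulr_ge0.
  by rewrite !fctE normrM -mulrA ler_wpM2l// dual_norm_ge.
have [tE|t0] := eqVneq t 0.
  by rewrite {1}tE normr0 mul0r; exact: dual_norm_ge0.
have t1 : 0 < `|t| by rewrite normr_gt0.
rewrite -ler_pdivlMl//; apply: dual_norm_le => [|h].
  by rewrite mulr_ge0 ?invr_ge0// dual_norm_ge0.
rewrite -mulrA ler_pdivlMl// -normrM; exact: dual_norm_ge.
Qed.

End DualNorm.

Section NormalCone.
Context {R : realType} {X : normedModType R}.
Implicit Types (f : X -> R) (Om : set X).

Lemma frechet_normal_coneP Om x f : frechet_normal_cone Om x (f : X -> R^o) <->
  dual_space (f : X -> R^o) /\ forall e : R, 0 < e -> exists2 r, 0 < r &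
    forall v, Om v -> `|v - x| < r -> f (v - x) <= e * `|v - x|.
Proof.
split=> -[df fN]; split=> //.
- move=> e e0; have e0E : (0%:E < e%:E)%E by rewrite lte_fin.
  have [_ [V FV <-] supV] := ereal_inf_lt (le_lt_trans fN e0E).
  have /nbhs_ballP[r /= r0 rV] := FV; exists r => // v Ov vr.
  have [->|vx] := eqVneq v x.
    by rewrite subrr (lin0 df.1) normr0 mulr0.
  have vx0 : 0 < `|v - x| by rewrite normr_gt0 subr_eq0.
  have Vv : V v by apply: rV => //; rewrite -ball_normE /ball_/= distrC.
  rewrite -ler_pdivrMr// -lee_fin; apply: le_trans (ltW supV).
  by apply: ereal_sup_ubound; exists v.
- apply/lee_addgt0Pr => e e0; rewrite add0e.
  have [r r0 rP] := fN e e0.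
  pose V := [set v | [/\ Om v, `|v - x| < r & v != x]].
  apply: (@le_trans _ _ (ereal_sup
    ((fun v => (f (v - x) / `|v - x|)%:E) @` V))).
    apply: ereal_inf_lbound; exists V => //.
    apply/nbhs_ballP; exists r => //= v; rewrite -ball_normE /ball_/= distrC.
    by move=> vr vx Ov; split.
  apply: ge_ereal_sup => _ [v [Ov vr vx] <-]; rewrite lee_fin.
  by rewrite ler_pdivrMr ?normr_gt0 ?subr_eq0//; exact: rP.
Qed.

End NormalCone.

(** * Transfer to the product space *)

Section ProductSpace.
Context {R : realType} {X : completeNormedModType R} {n : nat}.
Implicit Types (Om : 'I_n -> set X) (x v : 'I_n -> X).
Local Notation N := (@max_norm R X n).

Let sN := @max_norm_seminorm R X n.

(** A functional splits into [n] coordinate functionals. The net in [X] is taken over the sequence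
    of all coordinates, and [n]-tuples of net indices are enumerated. *)
Lemma product_separable_dual : asplund X -> separable_dual N.
Proof.
move=> aX s.
pose S k := if unpickle k is Some (m, i) then s m i else 0.
have SE m i : S (pickle (m, i : 'I_n)) = s m i by rewrite /S pickleK.
have [c [cb cd]] := asplund_dual_separable S aX.
pose d j (h : 'I_n -> X) := if unpickle j is Some phi
  then \sum_(i < n) c ((phi : {ffun 'I_n -> nat}) i) (h i) else 0.
exists d, n%:R; split=> //.
- move=> j; rewrite /d; case: (unpickle j) => [phi|]; last first.
    by apply: linear_funP => *; rewrite ?addr0 ?mulr0.
  apply: linear_funP => [x y|t x].
    by rewrite -big_split; apply: eq_bigr => i _; rewrite (linD _ _ (cb _).1).
  by rewrite mulr_sumr; apply: eq_bigr => i _; rewrite (linZ _ _ (cb _).1).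
- move=> j h; rewrite /d; case: (unpickle j) => [phi|]; last first.
    by rewrite normr0 mulr_ge0// max_norm_ge0.
  apply: le_trans (ler_norm_sum _ _ _) _.
  apply: le_trans (_ : \sum_(i < n) N h <= _).
    apply: ler_sum => i _; apply: le_trans (_ : `|h i| <= _); last exact: max_norm_ge.
    have [cl ch] := cb (phi i); rewrite ler_norml ch andbT lerNl -(linN _ cl).
    by rewrite -[leRHS]normrN; exact: ch.
  by rewrite sumr_const card_ord -[leLHS]mulr_natl.
move=> f e pf e0; have [lf fN] := pf.
have pi i : polar (fun x : X => `|x|) (fun h => f (single i h)).
  split; first exact: lin_single.
  by move=> h; rewrite -(max_norm_single i); exact: fN.
(* [n.+1] keeps the denominator positive for [n = 0]. *)
have en : 0 < e / n.+1%:R by rewrite divr_gt0.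
have /choice[phi phiP] : forall i, exists j, forall m,
    `|f (single i (s m i)) - c j (s m i)| <= e / n.+1%:R * `|s m i|.
  move=> i; have [j jP] := cd _ _ (pi i) en; exists j => m.
  by have := jP (pickle (m, i)); rewrite SE.
exists (pickle [ffun i => phi i]) => m; rewrite /d pickleK.
rewrite (lin_decomp _ lf) -sumrB; apply: le_trans (ler_norm_sum _ _ _) _.
apply: le_trans (_ : \sum_(i < n) e / n.+1%:R * N (s m) <= _).
  apply: ler_sum => i _; rewrite ffunE; apply: le_trans (phiP i m) _.
  by rewrite ler_pM2l// max_norm_ge.
rewrite sumr_const card_ord -[leLHS]mulr_natl mulrA ler_wpM2r ?max_norm_ge0//.
by rewrite mulrCA -[leRHS]mulr1 ler_pM2l// ler_pdivrMr// mul1r ler_nat.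
Qed.

Lemma norm_complete (u : nat -> X) : seq_cauchy (fun x y : X => `|x - y|) u ->
  exists l, seq_cvg (fun x y : X => `|x - y|) u l /\ forall A, closed A ->
    (forall k, A (u k)) -> A l.
Proof.
move=> uc; have uc' : cvg (u @ \oo).
  apply: cauchy_cvg; apply: cauchy_exP => e e0.
  have [|M MP] := uc (e / 2); first by rewrite divr_gt0.
  exists (u M); exists M => // k /= Mk; rewrite -ball_normE /ball_/=.
  by apply: le_lt_trans (MP M k (leqnn _) Mk) _; lra.
exists (lim (u @ \oo)); split=> [e e0|A cA uA].
  have /cvgrPdist_le /(_ e e0)[M _ MP] := uc'.
  by exists M => k Mk; rewrite distrC; exact: MP.
by apply: (closed_cvg A cA _ _ uc'); apply: nearW.
Qed.

Lemma product_complete Om : (forall i, closed (Om i)) ->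
  seq_complete (fun x y => N (x - y)) (product_set Om).
Proof.
move=> cO u uO uc.
have /choice[l lP] : forall i, exists l, seq_cvg (fun x y : X => `|x - y|) (fun k => u k i) l /\
    Om i l.
  move=> i; have [|l [ul lA]] := @norm_complete (fun k => u k i).
    move=> e e0; have [M MP] := uc e e0; exists M => k m Mk km.
    by apply: le_trans (MP k m Mk km); exact: (max_norm_ge (u k - u m) i).
  by exists l; split=> //; apply: lA => // k; exact: uO.
exists l; first by move=> i; have [] := lP i.
move=> e e0; have /choice[M MP] : forall i, exists M, forall k, (M <= k)%N ->
    `|u k i - l i| <= e by move=> i; have [/(_ e e0)] := lP i.
exists (\max_i M i) => k Mk; apply: max_norm_le => [|i]; first exact: ltW.
by apply: MP; exact: leq_trans (leq_bigmax i) Mk.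
Qed.

Lemma product_conormal_exists Om (q : ('I_n -> X) -> R) v0 b gamma eta :
  asplund X \/ (forall i, convex_set (Om i : set (convex_lmodType X))) ->
  (forall i, closed (Om i)) -> seminorm q -> (forall k, q k <= N k) ->
  product_set Om v0 -> 0 < gamma -> 0 < eta ->
  (forall v, product_set Om v -> q b <= q (v - v0 + b) + gamma * N (v - v0)) ->
  exists x f, conormal_at N q (product_set Om) v0 b gamma eta x f.
Proof.
move=> [aX|cvx] cO sq qN Ov0 g0 eta0 Om_min.
  apply: conormal_exists_separable_dual => //; first exact: product_separable_dual.
  exact: product_complete.
apply: conormal_exists_convex => // t x y t0 t1 Ox Oy i.
have := cvx i (x i) (y i) (Itv01 t0 t1).
by rewrite !inE; apply.
Qed.

Lemma conormal_coord Om x f i : linear_fun f -> product_set Om x ->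
  frechet_conormal N (product_set Om) x f -> forall e : R, 0 < e ->
  exists2 r, 0 < r & forall v : X, Om i v -> `|v - x i| < r ->
    - (e * `|v - x i|) <= f (single i (v - x i)).
Proof.
move=> lf Ox fN e e0; have [r r0 rP] := fN e e0; exists r => // v Ov vr.
have E : (fun j => if j == i then v else x j) - x = single i (v - x i).
  apply/funext => j; rewrite /single !fctE; case: eqP => [->//|_].
  by rewrite subrr.
have := rP (fun j => if j == i then v else x j); rewrite E max_norm_single; apply=> //.
by move=> j; case: eqP => [->//|_]; exact: Ox.
Qed.

End ProductSpace.

(** * The distance to the intersection of the shifted sets *)

Section Zeta.
Context {R : realType} {X : normedModType R} {n : nat}.
Implicit Types (Om : 'I_n -> set X) (x : 'I_n -> X).

Lemma zeta_le Om x (z : X) : (forall i, Om i (x i + z)) -> (zeta Om x <= `|z|%:E)%E.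
Proof.
move=> Oz; apply: ereal_inf_lbound; exists z.
  by move=> i _; exists (x i + z); rewrite // addrC addKr.
by rewrite edist_normE sub0r normrN.
Qed.

Lemma zeta_ge Om x (r : R) :
  (forall z : X, (forall i, Om i (x i + z)) -> r <= `|z|) -> (r%:E <= zeta Om x)%E.
Proof.
move=> rz; apply: le_ereal_inf_tmp => _ [z Oz <-].
rewrite edist_normE sub0r normrN lee_fin; apply: rz => i.
by have [w Ow <-] := Oz i Logic.I; rewrite subrKC.
Qed.

Lemma zeta_ratio_lt Om x (c alpha : R) (z : X) : 0 < c -> 0 < alpha ->
  (c%:E / zeta Om x < alpha%:E)%E -> (forall i, Om i (x i + z)) -> c < alpha * `|z|.
Proof.
move=> c0 a0 + /zeta_le; have z0 : (0 <= zeta Om x)%E.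
  by apply: zeta_ge => w _.
move: (zeta Om x) z0 => [r| |]//; rewrite !lee_fin => r0 + rz.
(* Distance 0 is ruled out by the convention [c / 0 = +oo]. *)
have [->|rn] := eqVneq r 0; first by rewrite inve0 mulry gtr0_sg// mul1e.
rewrite inver (negbTE rn) -EFinM lte_fin ltr_pdivrMr; last first.
  by rewrite lt_neqAle eq_sym rn.
by move=> h; apply: lt_le_trans h _; rewrite ler_pM2l.
Qed.

End Zeta.

Section InfConvolution.
Context {R : realType} {X : normedModType R} {n : nat}.
Local Notation N := (@max_norm R X n).
Variables (alpha : R) (a0 : 0 < alpha).

(** Infimal convolution of the maximum norm with [alpha] times the norm on the diagonal. A linear
    functional is below it exactly when it is below [N] and at most [alpha] times the norm of [h] at
    each constant tuple [h]. *)
Definition common_shift (k : 'I_n -> X) : R :=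
  inf [set N (k - (fun=> z)) + alpha * `|z| | z in [set: X]].

Let lb k r : [set N (k - (fun=> z)) + alpha * `|z| | z in [set: X]] r -> 0 <= r.
Proof. by move=> [z _ <-]; rewrite addr_ge0// ?max_norm_ge0// mulr_ge0// ltW. Qed.

Let ne k : [set N (k - (fun=> z)) + alpha * `|z| | z in [set: X]] !=set0.
Proof. by exists (N (k - (fun=> 0)) + alpha * `|0 : X|), 0. Qed.

Lemma common_shift_le k z : common_shift k <= N (k - (fun=> z)) + alpha * `|z|.
Proof. by apply: inf_le_mem (@lb k) _; exists z. Qed.

Lemma common_shift_ge k c : (forall z, c <= N (k - (fun=> z)) + alpha * `|z|) ->
  c <= common_shift k.
Proof. by move=> h; apply: lb_le_inf => // _ [z _ <-]. Qed.

Lemma common_shift_le_norm k : common_shift k <= N k.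
Proof.
have := common_shift_le k 0; rewrite normr0 mulr0 addr0.
by rewrite (_ : k - (fun=> 0) = k)//; apply/funext => i; rewrite !fctE subr0.
Qed.

Lemma common_shift_seminorm : seminorm common_shift.
Proof.
have sN := @max_norm_seminorm R X n.
have q0 k : 0 <= common_shift k.
  by apply: common_shift_ge => z; apply: lb; exists z.
split=> [x y|t x].
  apply/ler_addgt0Pr => e e0.
  have [|_ [z _ <-] hz] := inf_ltP (@lb x) (ne x)
    (_ : common_shift x < common_shift x + e / 2); first by lra.
  have [|_ [w _ <-] hw] := inf_ltP (@lb y) (ne y)
    (_ : common_shift y < common_shift y + e / 2); first by lra.
  have := common_shift_le (x + y) (z + w).
  have -> : x + y - (fun=> z + w) = (x - (fun=> z)) + (y - (fun=> w)).
    by apply/funext => i; rewrite !fctE opprD addrACA.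
  have := sN.1 (x - (fun=> z)) (y - (fun=> w)).
  have := ler_normD z w; rewrite -(ler_pM2l a0); lra.
have le s y : s != 0 -> common_shift (s *: y) <= `|s| * common_shift y.
  move=> s0; rewrite -ler_pdivrMl ?normr_gt0//; apply: common_shift_ge => z.
  rewrite ler_pdivrMl ?normr_gt0//; have := common_shift_le (s *: y) (s *: z).
  have -> : s *: y - (fun=> s *: z) = s *: (y - (fun=> z)).
    by apply/funext => i; rewrite !fctE scalerBr.
  by rewrite sN.2 normrZ; lra.
have [->|t0] := eqVneq t 0.
  rewrite normr0 mul0r scale0r; apply/eqP; rewrite eq_le q0 andbT.
  by have := common_shift_le_norm 0; rewrite (seminorm0 sN).
apply/eqP; rewrite eq_le le//=.
rewrite -ler_pdivlMl ?normr_gt0//; have := le t^-1 (t *: x).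
by rewrite scalerA mulVf// scale1r normfV invr_eq0; apply.
Qed.

Lemma common_shift_cst (h : X) : common_shift (fun=> h) <= alpha * `|h|.
Proof.
have := common_shift_le (fun=> h) h.
rewrite (_ : (fun=> h) - (fun=> h) = 0 :> ('I_n -> X)); last first.
  by apply/funext => i; rewrite !fctE subrr.
by rewrite (seminorm0 (@max_norm_seminorm R X n)) add0r.
Qed.

End InfConvolution.

Section NormalsFromConormal.
Context {R : realType} {X : completeNormedModType R} {n : nat}.
Local Notation N := (@max_norm R X n).

(** The bounds at [y] make the norms of the coordinates of [f] sum to at least [s]; dividing by this
    sum and changing the sign gives the normals. *)
Lemma normals_of_functional (Om : 'I_n -> set X) x y f (c s M : R) :
  product_set Om x -> linear_fun f -> frechet_conormal N (product_set Om) x f ->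
  0 < s -> 0 < M -> 0 <= c -> s * M <= f y -> N y <= M ->
  (forall h, f h <= c * N h) ->
  forall a, 0 <= a -> (forall h : X, f (fun=> h) <= a * `|h|) ->
  exists xs : 'I_n -> X -> R^o,
    [/\ forall i, frechet_normal_cone (Om i) (x i) (xs i),
        \sum_(i < n) dual_norm (xs i) = 1 &
        dual_norm (\sum_(i < n) xs i) <= a / s].
Proof.
move=> Ox lf fN s0 M0 c0 fy yM fc a a0 fa.
pose g i h := f (single i h).
have dg i : dual_space (g i : X -> R^o).
  apply: (@lin_bounded_dual _ _ _ c); first exact: lin_single.
  by move=> h; rewrite -(max_norm_single i); exact: fc.
pose S := \sum_(i < n) dual_norm (g i : X -> R^o).
have Ss : s <= S.
  rewrite -(ler_pM2r M0); apply: le_trans fy _.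
  rewrite (lin_decomp _ lf) mulr_suml; apply: ler_sum => i _.
  apply: le_trans (ler_norm _) _; apply: le_trans (dual_norm_ge _ (dg i)) _.
  apply: ler_wpM2l; first exact: dual_norm_ge0.
  exact: le_trans (max_norm_ge y i) yM.
have S0 : 0 < S by lra.
have SV0 : 0 < S^-1 by rewrite invr_gt0.
pose xs i : X -> R^o := (- S^-1) *: (g i : X -> R^o).
have xsN i : dual_norm (xs i) = S^-1 * dual_norm (g i : X -> R^o).
  by rewrite dual_normZ// normrN gtr0_norm ?invr_gt0.
exists xs; split.
- move=> i; apply/frechet_normal_coneP; split.
    apply: (@lin_bounded_dual _ _ _ (S^-1 * dual_norm (g i : X -> R^o))).
      apply: linear_funP => [h k|t h]; rewrite /xs !fctE.
        by rewrite (linD _ _ (dg i).1) scalerDr.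
      by rewrite (linZ _ _ (dg i).1) /GRing.scale/=; ring.
    move=> h; rewrite /xs !fctE; apply: le_trans (ler_norm _) _.
    rewrite -[_ *: _]/(- S^-1 * g i h) normrM normrN (gtr0_norm SV0) -[leRHS]mulrA ler_pM2l//.
    exact: dual_norm_ge.
  move=> e e0; have [r r0 rP] := conormal_coord i lf Ox fN (mulr_gt0 e0 S0).
  exists r => // v Ov vr; have := rP v Ov vr.
  rewrite -/(g i _) /xs !fctE => h.
  rewrite -[_ *: _]/(- S^-1 * g i (v - x i)) mulNr lerNl.
  by rewrite [S^-1 * _]mulrC ler_pdivlMr//; move: h; lra.
- under eq_bigr do rewrite xsN.
  by rewrite -mulr_sumr mulVf// gt_eqF.
have -> : \sum_(i < n) xs i = (- S^-1) *: (fun h => f (fun=> h) : R^o).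
  apply/funext => h; rewrite fct_sumE.
  transitivity (- S^-1 * f (fun=> h)); last by [].
  by rewrite (lin_decomp _ lf) mulr_sumr; apply: eq_bigr.
have fcst h : `|f (fun=> h)| <= a * `|h|.
  have E : (fun=> - h) = - (fun=> h) :> ('I_n -> X) by [].
  by rewrite ler_norml fa andbT lerNl -(linN _ lf) -E -[`|h|]normrN; exact: fa.
have lcst : linear_fun (fun h : X => f (fun=> h)).
  apply: linear_funP => [h k|t h].
    by rewrite -(linD _ _ lf).
  by rewrite -(linZ _ _ lf).
rewrite dual_normZ; last exact: (lin_bounded_dual lcst fa).
rewrite normrN (gtr0_norm SV0).
apply: le_trans (_ : S^-1 * a <= _).
  by rewrite ler_pM2l ?invr_gt0//; exact: dual_norm_le.
by rewrite mulrC ler_wpM2l// lef_pV2// posrE.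
Qed.

End NormalsFromConormal.

(** * From a small ratio to normals *)

Section ExtremalPrinciple.
Context {R : realType} {X : completeNormedModType R} {n : nat}.
Local Notation N := (@max_norm R X n).
Variable Om : 'I_n -> set X.
Hypothesis (cO : forall i, closed (Om i)).
Hypothesis (aO : asplund X \/ (forall i, convex_set (Om i : set (convex_lmodType X)))).

Let sN := @max_norm_seminorm R X n.

(** Ekeland's principle for pairs of a point and a common shift, started at [(u, 0)] where the
    residual is [N a]. The weight [alpha] on shifts becomes the bound on the sum of the functionals;
    the weight [gamma] on points is a small error. *)
Lemma ekeland_pair (alpha gamma : R) u a : 0 < alpha -> 0 < gamma ->
  product_set Om u -> exists v z, [/\ product_set Om v,
    N (v - u - a - (fun=> z)) + alpha * `|z| + gamma * N (v - u) <= N a &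
    forall v' z', product_set Om v' -> N (v - u - a - (fun=> z)) <=
      N (v' - u - a - (fun=> z')) + alpha * `|z - z'| + gamma * N (v - v')].
Proof.
move=> a0 g0 Ou.
pose d (s t : ('I_n -> X) * X) := alpha * `|s.2 - t.2| + gamma * N (s.1 - t.1).
pose A := [set s : ('I_n -> X) * X | product_set Om s.1].
pose phi (s : ('I_n -> X) * X) := N (s.1 - u - a - (fun=> s.2)).
have sub4 (V : zmodType) (x w z y z' : V) :
    x - w - z - (y - w - z') = (x - y) - (z - z').
  by rewrite !opprD !opprK addrACA (addrACA x) addNr addr0.
have phiL s t : phi s <= phi t + N (s.1 - t.1) + `|s.2 - t.2|.
  have := sN.1 (t.1 - u - a - (fun=> t.2))
    ((s.1 - u - a - (fun=> s.2)) - (t.1 - u - a - (fun=> t.2))).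
  rewrite subrKC sub4 (_ : s.1 - u - (t.1 - u) = s.1 - t.1) -/(phi s) -/(phi t) => [h|]; last by rewrite opprB addrA subrK.
  have := sN.1 (s.1 - t.1) (- ((fun=> s.2) - (fun=> t.2))).
  rewrite (seminormN sN) => h2.
  have : N ((fun=> s.2) - (fun=> t.2)) <= `|s.2 - t.2| by exact: max_norm_le.
  by lra.
have [||||||||[v z] [/= Av vz] vzmin] := @ekeland R _ d A phi (u, 0).
- by move=> x; rewrite /d !subrr normr0 (seminorm0 sN) !mulr0 addr0.
- by move=> x y; rewrite /d distrC (seminormB sN).
- move=> x y; rewrite /d addr_ge0 ?mulr_ge0//; try exact: ltW.
  exact: max_norm_ge0.
- move=> x y t; rewrite /d.
  have := sN.1 (x.1 - y.1) (y.1 - t.1); rewrite addrA subrK => h1.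
  have h2 := ler_distD y.2 x.2 t.2.
  by have := ler_wpM2l (ltW g0) h1; have := ler_wpM2l (ltW a0) h2; lra.
- move=> w Aw wc.
  have [|v1 Ov1 cv1] := product_complete cO Aw.
    move=> e e0; have [M MP] := wc (gamma * e) (mulr_gt0 g0 e0); exists M => k m Mk km.
    have := MP k m Mk km; rewrite /d -[X in _ -> is_true X](ler_pM2l g0).
    by have := mulr_ge0 (ltW a0) (normr_ge0 ((w k).2 - (w m).2)); lra.
  have [|z1 [cz1 _]] := @norm_complete R X (fun k => (w k).2).
    move=> e e0; have [M MP] := wc (alpha * e) (mulr_gt0 a0 e0); exists M => k m Mk km.
    have := MP k m Mk km; rewrite /d -[X in _ -> is_true X](ler_pM2l a0).
    by have := mulr_ge0 (ltW g0) (max_norm_ge0 ((w k).1 - (w m).1)); lra.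
  exists (v1, z1) => // e e0.
  have [|M1 MP1] := cv1 (e / (2 * gamma)); first by rewrite divr_gt0// mulr_gt0.
  have [|M2 MP2] := cz1 (e / (2 * alpha)); first by rewrite divr_gt0// mulr_gt0.
  exists (maxn M1 M2) => k; rewrite geq_max => /andP[/MP1 + /MP2].
  by rewrite /d/= !ler_pdivlMr ?mulr_gt0//; lra.
- by move=> x; exact: max_norm_ge0.
- move=> x e e0; pose mn := Num.min alpha gamma.
  have mn0 : 0 < mn by rewrite lt_min a0.
  exists (e * mn); first by rewrite mulr_gt0.
  move=> y; rewrite /d => h; have := phiL x y.
  rewrite distrC (seminormB sN x.1) => h2.
  have ma : mn * `|y.2 - x.2| <= alpha * `|y.2 - x.2|.
    by rewrite ler_wpM2r// ge_min lexx.
  have mg : mn * N (y.1 - x.1) <= gamma * N (y.1 - x.1).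
    by rewrite ler_wpM2r ?max_norm_ge0// ge_min lexx orbT.
  have : mn * (`|y.2 - x.2| + N (y.1 - x.1)) <= mn * e by lra.
  by rewrite ler_pM2l//; lra.
- exact: Ou.
exists v, z; split=> //.
  have : phi (u, 0) = N a.
    rewrite /phi /= -(seminormN sN a); congr N.
    by apply/funext => i; rewrite !fctE subrr sub0r subr0.
  move: vz; rewrite /d /phi /= sub0r normrN (seminormB sN u) => + <-.
  by rewrite addrA.
move=> v' z' Ov'; have := vzmin (v', z') Ov'.
by rewrite /d /phi /= addrA.
Qed.

Lemma extremal_normals (alpha' alpha : R) : 0 < alpha' -> alpha' < alpha ->
  exists2 K, 0 < K & forall u a, product_set Om u -> a <> 0 ->
    ((N a)%:E / zeta Om (u + a)%R < alpha'%:E)%E ->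
    exists x (xs : 'I_n -> X -> R^o),
    [/\ product_set Om x, forall i, frechet_normal_cone (Om i) (x i) (xs i),
        N (x - u) <= K * N a, \sum_(i < n) dual_norm (xs i) = 1 &
        dual_norm (\sum_(i < n) xs i) <= alpha].
Proof.
move=> a'0 aa.
(* Before normalisation the sum of the functionals has norm at most [alpha' + 4 * gamma], while
   their norms sum to at least [1 - 6 * gamma]; the quotient must not exceed [alpha]. *)
have [gamma [g0 g1 ga]] : exists gamma : R, [/\ 0 < gamma, gamma <= 12^-1 &
    alpha' + 4 * gamma <= alpha * (1 - 6 * gamma)].
  have den : 0 < 4 + 6 * alpha by lra.
  exists (Num.min 12^-1 ((alpha - alpha') / (4 + 6 * alpha))); split.
  - by rewrite lt_min divr_gt0 ?subr_gt0// andbT invr_gt0.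
  - by rewrite ge_min lexx.
  - set g := Num.min _ _; have : g * (4 + 6 * alpha) <= alpha - alpha'.
      by rewrite -ler_pdivlMr// /g ge_min lexx orbT.
    lra.
exists (1 + gamma^-1); first by rewrite addr_gt0// invr_gt0.
move=> u a Ou an0 ratio.
have Na := max_norm_gt0 an0.
have sep z : (forall i, Om i ((u + a) i + z)) -> N a < alpha' * `|z|.
  exact: zeta_ratio_lt.
have [v [z [Ov vz vmin]]] := ekeland_pair a a'0 g0 Ou.
set b := v - u - a - (fun=> z) in vz vmin.
have vE i : (u + a) i + z = v i - b i.
  by rewrite /b !fctE !opprD !opprK !addrA subrr add0r.
(* A zero residual would put the shifted sets in contact at [z] with [alpha' * |z| <= N a], against
   [sep]. *)
have b0 : 0 < N b.
  rewrite lt_neqAle max_norm_ge0 andbT eq_sym; apply/eqP => Nb0.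
  have bi i : b i = 0.
    by apply/eqP; rewrite -normr_le0; have := max_norm_ge b i; rewrite Nb0.
  have := sep z; rewrite ltNge => /(_ _)/negP; apply.
    by move=> i; rewrite vE bi subr0.
  have := mulr_ge0 (ltW g0) (max_norm_ge0 (v - u)).
  by move: vz; rewrite Nb0; lra.
pose q := @common_shift R X n alpha'.
(* Minimality with [v] kept fixed: no further shift pays off at the price [alpha']. *)
have qb : q b = N b.
  apply/eqP; rewrite eq_le common_shift_le_norm//=; apply: common_shift_ge => y.
  have := vmin v (z + y) Ov; rewrite subrr (seminorm0 sN) mulr0 addr0.
  rewrite (_ : z - (z + y) = - y) ?normrN; last by rewrite opprD addNKr.
  rewrite (_ : v - u - a - (fun=> z + y) = b - (fun=> y))//.
  by apply/funext => i; rewrite /b !fctE opprD addrA.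
(* The first bound keeps [x - v + b] comparable with [b]; the second gives the summand 1 of the
   constant, whose summand [gamma^-1] bounds [N (v - u)]. *)
pose eta := Num.min (N b * gamma) (N a).
have eta0 : 0 < eta by rewrite lt_min mulr_gt0.
have [|||x [f [[Ox xv] lf fq fb fN]]] := @product_conormal_exists R X n Om q v b
   gamma eta aO cO _ _ Ov g0 eta0.
- exact: common_shift_seminorm.
- exact: common_shift_le_norm.
- move=> w Ow; rewrite qb.
  rewrite -lerBlDr; apply: common_shift_ge => y; rewrite lerBlDr.
  have := vmin w (z + y) Ow; rewrite (seminormB sN v).
  rewrite (_ : z - (z + y) = - y) ?normrN; last by rewrite opprD addNKr.
  rewrite (_ : w - u - a - (fun=> z + y) = w - v + b - (fun=> y)); first by lra.
  apply/funext => i; rewrite /b !fctE.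
  by rewrite opprD !addrA subrK.
have e1 : eta <= N b * gamma by rewrite ge_min lexx.
have e2 : eta <= N a by rewrite ge_min lexx orbT.
have gb : 0 < N b * gamma by rewrite mulr_gt0.
have s0 : 0 < 1 - 6 * gamma by lra.
have M0 : 0 < N b * (1 + gamma) by rewrite mulr_gt0//; lra.
have c0 : 0 <= 1 + 4 * gamma by lra.
have xy : N (x - v + b) <= N b * (1 + gamma).
  by have := sN.1 (x - v) b; lra.
(* [fb] yields [(1 - 5 * gamma) * N b], and [(1 - 6 * gamma) * (1 + gamma) <= 1 - 5 * gamma]. *)
have fy : (1 - 6 * gamma) * (N b * (1 + gamma)) <= f (x - v + b).
  have := mulr_gt0 gb g0; move: fb; rewrite qb; lra.
have fc h : f h <= (1 + 4 * gamma) * N h.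
  by have := fq h; have := common_shift_le_norm a'0 h; rewrite /q; lra.
have ag0 : 0 <= alpha' + 4 * gamma by lra.
have fa (h : X) : f (fun=> h) <= (alpha' + 4 * gamma) * `|h|.
  have := fq (fun=> h); have := @common_shift_cst R X n alpha' a'0 h.
  have : 4 * gamma * N (fun=> h) <= 4 * gamma * `|h|.
    by rewrite ler_wpM2l ?mulr_ge0 ?(ltW g0)//; exact: max_norm_le.
  by rewrite /q; lra.
have [xs [xs1 xs2 xs3]] := normals_of_functional Ox lf fN s0 M0 c0 fy xy fc ag0 fa.
exists x, xs; split=> //.
  have := sN.1 (x - v) (v - u); rewrite addrA subrK => h.
  have : N (v - u) <= gamma^-1 * N a.
    rewrite ler_pdivlMl//; have := max_norm_ge0 b.
    by have := mulr_ge0 (ltW a'0) (normr_ge0 z); lra.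
  by lra.
by apply: le_trans xs3 _; rewrite ler_pdivrMr.
Qed.

End ExtremalPrinciple.

(** * From normals to a perturbation with small ratio *)

Section Converse.
Context {R : realType} {X : normedModType R} {n : nat}.
Local Notation N := (@max_norm R X n).
Implicit Types (Om : 'I_n -> set X).

Lemma common_radius (r : 'I_n -> R) : (forall i, 0 < r i) ->
  exists2 d, 0 < d & forall i, d <= r i.
Proof.
move=> r0; have S0 : 0 < 1 + \sum_(i < n) (r i)^-1.
  by rewrite ltr_wpDr// sumr_ge0// => i _; rewrite invr_ge0 ltW.
exists (1 + \sum_(i < n) (r i)^-1)^-1; first by rewrite invr_gt0.
move=> i; rewrite invf_ple ?posrE//; rewrite (bigD1 i)//= addrCA lerDl.
by rewrite addr_ge0// sumr_ge0// => j _; rewrite invr_ge0 ltW.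
Qed.

(** Take [a i = rho *: h i] with [h i] almost norming [xs i]. For a small [z] common to the shifted
    sets, the summed normal inequalities give [rho * (1 - c) <= (s + c) * |z|], with [s] the norm of
    the sum. *)
Lemma ratio_le_of_normals Om x (xs : 'I_n -> X -> R^o) (tau e0 : R) :
  (forall i, frechet_normal_cone (Om i) (x i) (xs i)) ->
  \sum_(i < n) dual_norm (xs i) = 1 -> 0 < tau -> 0 < e0 ->
  exists a, [/\ a <> 0, N a <= e0 & ((N a)%:E / zeta Om (x + a)%R <=
    (dual_norm (\sum_(i < n) xs i) + tau)%:E)%E].
Proof.
move=> nx sx tau0 e00.
have dx i : dual_space (xs i) by have /frechet_normal_coneP[] := nx i.
have ds : dual_space (\sum_(i < n) xs i) by exact: dual_space_sum.
set s := dual_norm (\sum_(i < n) xs i).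
have s0 : 0 <= s by exact: dual_norm_ge0.
have s1 : s <= 1.
  apply: dual_norm_le => // h; rewrite fct_sumE; apply: le_trans (ler_norm_sum _ _ _) _.
  rewrite -sx mulr_suml; apply: ler_sum => i _; exact: dual_norm_ge.
(* Chosen so that [(s + c) / (1 - c) <= s + tau] for all [s <= 1]. *)
pose c := tau / (2 + tau).
have c0 : 0 < c by rewrite divr_gt0//; lra.
have cE : c * (2 + tau) = tau by rewrite /c divfK// gt_eqF//; lra.
have c1 : c < 1 by rewrite /c ltr_pdivrMr; lra.
(* An error [n * e], at most half of [c], occurs twice: in the choice of the [h i] and in the normal
   inequalities. *)
pose e := c / (2 * n.+1%:R).
have e_gt0 : 0 < e by rewrite divr_gt0// mulr_gt0.
have ne : 2 * (n%:R * e) <= c.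
  have -> : c = 2 * (n.+1%:R * e).
    by rewrite /e; field; rewrite gt_eqF.
  by rewrite ler_pM2l// ler_pM2r// ler_nat.
have /choice[r rP] : forall i, exists r : R, 0 < r /\ forall v, Om i v ->
    `|v - x i| < r -> xs i (v - x i) <= e * `|v - x i|.
  move=> i; have /frechet_normal_coneP[_ /(_ e e_gt0)[r r0 rP]] := nx i.
  by exists r.
have [d d0 dr] := common_radius (fun i => (rP i).1).
have /choice[h hP] : forall i, exists h : X, `|h| <= 1 /\ dual_norm (xs i) - e < xs i h.
  by move=> i; have [h h1 h2] := dual_norm_near (dx i) e_gt0; exists h.
pose q := (1 - c) / (s + c).
have sc : 0 < s + c by lra.
have q0 : 0 < q by rewrite divr_gt0//; lra.
pose rho := Num.min e0 (d / (2 * (1 + q))).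
have q1 : 0 < 2 * (1 + q) by lra.
have rho0 : 0 < rho by rewrite lt_min e00 divr_gt0.
have rhod : rho * (1 + q) < d.
  have : rho * (2 * (1 + q)) <= d by rewrite -ler_pdivlMr// ge_min lexx orbT.
  have := mulr_gt0 rho0 q0; lra.
pose a : 'I_n -> X := fun i => rho *: h i.
have sumh : 1 - n%:R * e <= \sum_(i < n) xs i (h i).
  have -> : n%:R * e = \sum_(i < n) e by rewrite sumr_const card_ord mulr_natl.
  by rewrite -sx -sumrB; apply: ler_sum => i _; exact/ltW/(hP i).2.
have Na : N a <= rho.
  apply: max_norm_le => [|i]; first exact: ltW.
  rewrite /a normrZ gtr0_norm// -[leRHS]mulr1 ler_pM2l//; exact: (hP i).1.
have zge : ((rho * q)%:E <= zeta Om (x + a)%R)%E.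
  apply: zeta_ge => z Oz; rewrite leNgt; apply/negP => zq.
  have xz i : xs i (rho *: h i + z) <= e * (rho + `|z|).
    have E : (x + a) i + z - x i = rho *: h i + z by rewrite !fctE addrAC [x i + a i]addrC addrK.
    have Nz : `|rho *: h i + z| <= rho + `|z|.
      apply: le_trans (ler_normD _ _) _; rewrite lerD2r.
      exact: le_trans (max_norm_ge a i) Na.
    have := (rP i).2 _ (Oz i); rewrite E => /(_ _) h1.
    apply: le_trans (h1 _) _; last by rewrite ler_pM2l.
    by apply: lt_le_trans (dr i); apply: le_lt_trans Nz _; lra.
  have : \sum_(i < n) xs i (rho *: h i + z) <= n%:R * (e * (rho + `|z|)).
    apply: le_trans (_ : \sum_(i < n) e * (rho + `|z|) <= _).
      by apply: ler_sum => i _; exact: xz.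
    by rewrite sumr_const card_ord -[leLHS]mulr_natl.
  have -> : \sum_(i < n) xs i (rho *: h i + z) =
      rho * \sum_(i < n) xs i (h i) + (\sum_(i < n) xs i) z.
    rewrite fct_sumE mulr_sumr -big_split; apply: eq_bigr => i _ /=.
    by rewrite (linD _ _ (dx i).1) (linZ _ _ (dx i).1).
  have := dual_norm_ge z ds; rewrite -/s ler_norml => /andP[sz _].
  have h2 : rho * (1 - n%:R * e) <= rho * \sum_(i < n) xs i (h i) by rewrite ler_pM2l.
  have h3 : (2 * (n%:R * e)) * (rho + `|z|) <= c * (rho + `|z|).
    by rewrite ler_wpM2r// addr_ge0// ltW.
  have h4 : rho * (1 - c) = rho * q * (s + c) by rewrite /q; field; lra.
  have h5 : `|z| * (s + c) < rho * q * (s + c) by rewrite ltr_pM2r.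
  have h6 : 0 <= n%:R * e * `|z| by do 2?[apply: mulr_ge0 => //]; exact: ltW.
  by lra.
exists a; split.
- move=> a00; have hi i : h i = 0.
    have : a i = 0 by rewrite a00.
    by move=> /eqP; rewrite scaler_eq0 gt_eqF// => /eqP.
  move: sumh; rewrite big1 => [|i _]; last by rewrite hi (lin0 (dx i).1).
  lra.
- by apply: le_trans Na _; rewrite ge_min lexx.
have rq0 : 0 < rho * q by rewrite mulr_gt0.
move: (zeta Om (x + a)%R) zge => [t| |]//; last first.
  by move=> _; rewrite invey mule0 lee_fin; lra.
rewrite lee_fin => tq; have t0 : 0 < t by lra.
rewrite inver gt_eqF// -EFinM lee_fin ler_pdivrMr//.
apply: le_trans Na _; apply: le_trans (_ : (s + tau) * (rho * q) <= _); last first.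
  by rewrite ler_pM2l//; lra.
rewrite mulrCA -[leLHS]mulr1 ler_pM2l// /q mulrA ler_pdivlMr// mul1r.
have : c * s <= c * 1 by rewrite ler_pM2l.
by have := mulr_gt0 c0 tau0; lra.
Qed.

End Converse.

(** * Upper limits and diagonal indices *)

Section Sequences.
Context {R : realType}.
Implicit Types (u : nat -> \bar R) (s : nat -> R).

Lemma limn_esup_ltP u (c : R) : (limn_esup u < c%:E)%E ->
  exists2 c', c' < c & exists K, forall k, (K <= k)%N -> (u k <= c'%:E)%E.
Proof.
move=> /ereal_inf_lt[_ [V [K _ KV] <-] supV].
have uK k : (K <= k)%N -> (u k <= ereal_sup (u @` V))%E.
  by move=> Kk; apply: ereal_sup_ubound; exists k => //; exact: KV.
move: (ereal_sup (u @` V)) supV uK => [r| |]//.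
  by rewrite lte_fin => rc uK; exists r => //; exists K.
move=> _ uK; exists (c - 1); first by lra.
by exists K => k Kk; apply: le_trans (uK k Kk) _; rewrite leNye.
Qed.

Lemma limn_esup_leP u (c : \bar R) K : (forall k, (K <= k)%N -> (u k <= c)%E) ->
  (limn_esup u <= c)%E.
Proof.
move=> uc; apply: (@le_trans _ _ (ereal_sup (u @` [set k | (K <= k)%N]))).
  by apply: ereal_inf_lbound; exists [set k | (K <= k)%N] => //; exists K.
by apply: ge_ereal_sup => _ [k Kk <-]; exact: uc.
Qed.

Lemma cvg0P s : (forall k, 0 <= s k) -> s @ \oo --> (0 : R) <->
  forall e, 0 < e -> exists K, forall k, (K <= k)%N -> s k <= e.
Proof.
move=> s0; split=> [/cvgrPdist_le h e e0|h].
  have [K _ KP] := h e e0; exists K => k Kk.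
  by have := KP k Kk; rewrite /= sub0r normrN ger0_norm.
apply/cvgrPdist_le => e e0; have [K KP] := h e e0.
by exists K => // k /= Kk; rewrite sub0r normrN ger0_norm//; exact: KP.
Qed.

(** [mu k] is the largest [m <= k] with [K m <= k]; every [m] is eventually admissible, so [mu]
    tends to infinity for arbitrary [K]. *)
Lemma diagonal_index (K : nat -> nat) : exists mu : nat -> nat,
  (forall k, (K 0 <= k)%N -> (K (mu k) <= k)%N) /\
  forall m, exists M, forall k, (M <= k)%N -> (m <= mu k)%N.
Proof.
have /choice[mu muP] : forall k, exists m, ((K 0 <= k)%N -> (K m <= k)%N) /\
    forall m', (m' <= k)%N -> (K m' <= k)%N -> (m' <= m)%N.
  move=> k; have [K0|] := boolP (K 0 <= k)%N; last by exists k.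
  have ex : exists m, (m <= k)%N && (K m <= k)%N by exists 0%N.
  have ub m : (m <= k)%N && (K m <= k)%N -> (m <= k)%N by move=> /andP[].
  have [m /andP[mk Kmk] mmax] := ex_maxnP ex ub.
  by exists m; split=> // m' m'k Km'; apply: mmax; rewrite m'k.
exists mu; split=> [k|m]; first exact: (muP k).1.
exists (maxn m (K m)) => k; rewrite geq_max => /andP[mk Kk].
exact: (muP k).2.
Qed.

End Sequences.

(** * The two implications along sequences *)

Section Stationarity.
Context {R : realType} {X : completeNormedModType R} {n : nat}.
Local Notation N := (@max_norm R X n).
Variables (Om : 'I_n -> set X) (x0 : nat -> 'I_n -> X).


Let sN := @max_norm_seminorm R X n.

Let normal_seq (x : nat -> 'I_n -> X) (xs : nat -> 'I_n -> X -> R^o) :=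
  [/\ forall k, product_set Om (x k),
      forall k i, frechet_normal_cone (Om i) (x k i) (xs k i),
      max_norm (x k - x0 k) @[k --> \oo] --> (0 : R) &
      forall k, \sum_(i < n) dual_norm (xs k i) = 1].

Let perturbation x xs : normal_seq x xs -> exists2 a, null_nonzero_seq a &
  forall k, ((N (a k))%:E / zeta Om (x k + a k)%R <=
    (dual_norm (\sum_(i < n) xs k i) + harm k)%:E)%E.
Proof.
move=> [Ox nx _ sx].
have /choice[a aP] : forall k, exists a, [/\ a <> 0, N a <= harm k &
    ((N a)%:E / zeta Om (x k + a)%R <=
    (dual_norm (\sum_(i < n) xs k i) + harm k)%:E)%E].
  move=> k; have hk := @harm_gt0 R k.
  exact: (ratio_le_of_normals (nx k) (sx k) hk hk).
exists a; last by move=> k; have [] := aP k.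
split=> [k|]; first by have [] := aP k.
apply/cvg0P => [k|e e0]; first exact: max_norm_ge0.
have [K Ke] := harm_lt e0; exists K => k Kk; have [_ ak _] := aP k.
exact: le_trans ak (le_trans (le_harm Kk) (ltW Ke)).
Qed.

Let ratio_lb x xs a : normal_seq x xs ->
  (approx_stat_ratio Om x0 a <= stat_ratio Om x a)%E.
Proof. by move=> [Ox _ xx0 _]; apply: ereal_inf_lbound; exists x. Qed.

Lemma approx_alpha_stationary_of_normals (alpha : R) x xs : normal_seq x xs ->
  (limn_esup (fun k => (dual_norm (\sum_(i < n) xs k i))%:E) < alpha%:E)%E ->
  approx_alpha_stationary alpha Om x0.
Proof.
move=> nxs /limn_esup_ltP[c ca [K KP]].
have [a an aP] := perturbation nxs; exists a => //.
apply: le_lt_trans (ratio_lb a nxs) _.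
have [|L Lh] := @harm_lt R ((alpha - c) / 2); first by lra.
apply: (@le_lt_trans _ _ ((c + alpha) / 2)%:E); last by rewrite lte_fin; lra.
apply: (@limn_esup_leP _ _ _ (maxn K L)) => k; rewrite geq_max => /andP[Kk Lk].
apply: le_trans (aP k) _; rewrite lee_fin.
by have := KP k Kk; have := @le_harm R _ _ Lk; rewrite lee_fin; lra.
Qed.

Lemma approx_stationary_of_normals x xs : normal_seq x xs ->
  dual_norm (\sum_(i < n) xs k i) @[k --> \oo] --> (0 : R) ->
  approx_stationary Om x0.
Proof.
move=> nxs; have [Ox nx xx0 sx] := nxs.
have dn0 k : 0 <= dual_norm (\sum_(i < n) xs k i).
  apply: dual_norm_ge0; apply: dual_space_sum => i.
  by have /frechet_normal_coneP[] := nx k i.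
move=> /(cvg0P dn0) s0.
have [a an aP] := perturbation nxs; exists a => //.
apply/eqP; rewrite eq_le; apply/andP; split; last first.
  apply: le_ereal_inf_tmp => _ [u _ <-]; apply: limf_esup_ge0.
    by move=> [K _ /(_ K (leqnn _))].
  move=> k; rewrite mule_ge0// ?lee_fin ?max_norm_ge0// inve_ge0.
  by apply: zeta_ge => z _.
apply: le_trans (ratio_lb a nxs) _; apply/lee_addgt0Pr => e e0; rewrite add0e.
have [|K KP] := s0 (e / 2); first by lra.
have [|L Lh] := @harm_lt R (e / 2); first by lra.
apply: (@limn_esup_leP _ _ _ (maxn K L)) => k; rewrite geq_max => /andP[Kk Lk].
apply: le_trans (aP k) _; rewrite lee_fin.
by have := KP k Kk; have := @le_harm R _ _ Lk; lra.
Qed.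

Hypothesis (cO : forall i, closed (Om i)).
Hypothesis (aO : asplund X \/ (forall i, convex_set (Om i : set (convex_lmodType X)))).

Let normals_near (alpha eta : R) k (x : 'I_n -> X) (xs : 'I_n -> X -> R^o) :=
  [/\ product_set Om x, forall i, frechet_normal_cone (Om i) (x i) (xs i),
    N (x - x0 k) <= eta, \sum_(i < n) dual_norm (xs i) = 1 &
    dual_norm (\sum_(i < n) xs i) <= alpha].

Let eventually_normals a (c alpha eta : R) : null_nonzero_seq a ->
  0 < c -> c < alpha -> 0 < eta -> (approx_stat_ratio Om x0 a < c%:E)%E ->
  exists K, forall k, (K <= k)%N -> exists x xs, normals_near alpha eta k x xs.
Proof.
move=> [a0 /cvg0P an] c0 ca eta0.
move=> /ereal_inf_lt[_ [u [Ou /cvg0P ux0] <-] /limn_esup_ltP[c' cc' [K KP]]].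
have [L L0 LP] := extremal_normals cO aO c0 ca.
have [|K1 K1P] := an (fun k => max_norm_ge0 _) (eta / (2 * L)).
  by rewrite divr_gt0// mulr_gt0.
have [|K2 K2P] := ux0 (fun k => max_norm_ge0 _) (eta / 2); first by lra.
exists (maxn K (maxn K1 K2)) => k; rewrite !geq_max => /and3P[Kk /K1P + /K2P h2].
rewrite ler_pdivlMr ?mulr_gt0// => h1.
have [|x [xs [Ox nx xu sx dx]]] := LP (u k) (a k) (Ou k) (a0 k).
  by apply: le_lt_trans (KP k Kk) _; rewrite lte_fin.
exists x, xs; split=> //.
by have := sN.1 (x - u k) (u k - x0 k); rewrite addrA subrK; lra.
Qed.

(** Normals of accuracy [m] exist only from some index on, so the accuracy used at [k] has to grow
    slowly. A constant [al] serves [alpha]-stationarity. *)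
Let diagonal_normals (al : nat -> R) :
  (forall m, exists K, forall k, (K <= k)%N -> exists x xs,
     normals_near (al m) (harm m) k x xs) ->
  exists x xs, normal_seq x xs /\ exists mu : nat -> nat,
    (forall m, exists M, forall k, (M <= k)%N -> (m <= mu k)%N) /\
    exists K, forall k, (K <= k)%N -> dual_norm (\sum_(i < n) xs k i) <= al (mu k).
Proof.
move=> /choice[K KP]; have [mu [muK mu_oo]] := diagonal_index K.
(* Membership and normalisation are required at every index, so the indices below [K 0] borrow the
   normals found at [K 0]; limits do not see them. *)
have /choice[x /choice[xs xP]] : forall k, exists x xs,
    normals_near (al (mu (maxn k (K 0)))) (harm (mu (maxn k (K 0)))) (maxn k (K 0)) x xs.
  by move=> k; apply: KP; apply: muK; exact: leq_maxr.
have maxK k : (K 0 <= k)%N -> maxn k (K 0) = k by move=> /maxn_idPl.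
exists x, xs; split.
  split=> [k|k i||k]; try by have [] := xP k.
  apply/cvg0P => [k|e e0]; first exact: max_norm_ge0.
  have [m me] := harm_lt e0; have [M MP] := mu_oo m.
  exists (maxn M (K 0)) => k; rewrite geq_max => /andP[Mk Kk].
  have [_ _ + _ _] := xP k; rewrite maxK// => h; apply: le_trans h _.
  exact: le_trans (le_harm (MP k Mk)) (ltW me).
exists mu; split=> //; exists (K 0) => k Kk.
by have [_ _ _ _] := xP k; rewrite maxK.
Qed.

Lemma normals_of_approx_alpha_stationary (alpha : R) : 0 < alpha ->
  approx_alpha_stationary alpha Om x0 -> exists x xs, normal_seq x xs /\
  (limn_esup (fun k => (dual_norm (\sum_(i < n) xs k i))%:E) < alpha%:E)%E.
Proof.
move=> a0 [a an aa].
(* The extremal principle takes a positive bound, also when the stationarity ratio is 0. *)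
have [c [c0 ca ac]] : exists c : R, [/\ 0 < c, c < alpha & (approx_stat_ratio Om x0 a < c%:E)%E].
  move: (approx_stat_ratio Om x0 a) aa => [r| |]//.
    rewrite lte_fin => ra; exists ((Num.max r 0 + alpha) / 2).
    have [rm m0] : r <= Num.max r 0 /\ 0 <= Num.max r 0 by rewrite !le_max !lexx orbT.
    have ma : Num.max r 0 < alpha by rewrite gt_max ra.
    by rewrite lte_fin; split; lra.
  by move=> _; exists (alpha / 2); split; [lra|lra|exact: ltNyr].
pose c1 := (c + alpha) / 2.
have [x [xs [nxs [mu [_ [K KP]]]]]] : exists x xs, normal_seq x xs /\ exists mu : nat -> nat,
    (forall m, exists M, forall k, (M <= k)%N -> (m <= mu k)%N) /\
    exists K, forall k, (K <= k)%N -> dual_norm (\sum_(i < n) xs k i) <= c1.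
  apply: (diagonal_normals (al := fun=> c1)) => m.
  apply: eventually_normals an c0 _ (harm_gt0 m) ac; by rewrite /c1; lra.
exists x, xs; split=> //; apply: (@le_lt_trans _ _ c1%:E).
  by apply: (@limn_esup_leP _ _ _ K) => k Kk; rewrite lee_fin; exact: KP.
by rewrite lte_fin /c1; lra.
Qed.

Lemma normals_of_approx_stationary : approx_stationary Om x0 ->
  exists x xs, normal_seq x xs /\
  dual_norm (\sum_(i < n) xs k i) @[k --> \oo] --> (0 : R).
Proof.
move=> [a an aa].
have [x [xs [nxs [mu [mu_oo [K KP]]]]]] : exists x xs, normal_seq x xs /\ exists mu : nat -> nat,
    (forall m, exists M, forall k, (M <= k)%N -> (m <= mu k)%N) /\
    exists K, forall k, (K <= k)%N -> dual_norm (\sum_(i < n) xs k i) <= 2 * harm (mu k).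
  apply: (diagonal_normals (al := fun m => 2 * harm m)) => m.
  have h0 := @harm_gt0 R m.
  by apply: (eventually_normals an h0 _ h0); [lra|rewrite aa lte_fin].
have [_ nx _ _] := nxs.
exists x, xs; split=> //; apply/cvg0P => [k|e e0].
  apply: dual_norm_ge0; apply: dual_space_sum => i.
  by have /frechet_normal_coneP[] := nx k i.
have [|m me] := @harm_lt R (e / 2); first by lra.
have [M MP] := mu_oo m; exists (maxn M K) => k; rewrite geq_max => /andP[/MP Mk /KP h].
by have := @le_harm R _ _ Mk; lra.
Qed.

End Stationarity.

Theorem theorem3p2 (R : realType) (X : completeNormedModType R) (n : nat)
    (Omega : 'I_n -> set X) (alpha : R) (x0 : nat -> 'I_n -> X) :
  (1 < n)%N ->
  (forall i, Omega i !=set0) ->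
  (forall i, closed (Omega i)) ->
  0 < alpha ->
  asplund X \/ (forall i, convex_set (Omega i : set (convex_lmodType X))) ->
  (forall k, product_set Omega (x0 k)) ->
  (approx_alpha_stationary alpha Omega x0 <->
    exists (x : nat -> 'I_n -> X) (xs : nat -> 'I_n -> X -> R^o),
      [/\ forall k, product_set Omega (x k),
          forall k i, frechet_normal_cone (Omega i) (x k i) (xs k i),
          max_norm (x k - x0 k) @[k --> \oo] --> (0 : R),
          forall k, \sum_(i < n) dual_norm (xs k i) = 1 &
          (limn_esup (fun k => (dual_norm (\sum_(i < n) xs k i))%:E)
             < alpha%:E)%E])
  /\
  (approx_stationary Omega x0 <->
    exists (x : nat -> 'I_n -> X) (xs : nat -> 'I_n -> X -> R^o),
      [/\ forall k, product_set Omega (x k),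
          forall k i, frechet_normal_cone (Omega i) (x k i) (xs k i),
          max_norm (x k - x0 k) @[k --> \oo] --> (0 : R),
          forall k, \sum_(i < n) dual_norm (xs k i) = 1 &
          dual_norm (\sum_(i < n) xs k i) @[k --> \oo] --> (0 : R)]).
Proof.
move=> _ _ cO a0 aO _; split; split.
- move=> /(normals_of_approx_alpha_stationary cO aO a0)[x [xs [[h1 h2 h3 h4] h5]]].
  by exists x, xs.
- by move=> [x [xs [h1 h2 h3 h4]]]; exact: approx_alpha_stationary_of_normals.
- move=> /(normals_of_approx_stationary cO aO)[x [xs [[h1 h2 h3 h4] h5]]].
  by exists x, xs.
- by move=> [x [xs [h1 h2 h3 h4]]]; exact: approx_stationary_of_normals.
Qed.
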